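(* Let $m\ge2$ be an integer and $q_1,\dots,q_m\in[1,2]$ with $\frac1{q_1}+\cdots+\frac1{q_m}=\frac{m+1}{2}$ and \[ \max_i q_i<\frac{2m^2-4m+2}{m^2-m-1}. \] Then \[ B^{\mathbb K}_{m,(q_1,\dots,q_m)}\le\prod_{j=2}^m A_{\frac{2j-2}{j}}^{-1}. \]
   Context: $\mathbb K=\mathbb R$ or $\mathbb C$; $e_1,\dots,e_n$ denote the canonical unit vectors. For $(q_1,\dots,q_m)\in[1,2]^m$ with $\sum_k 1/q_k=\frac{m+1}{2}$, $B^{\mathbb K}_{m,(q_1,\dots,q_m)}$ denotes the optimal (smallest) constant $C\ge 1$ such that for every positive integer $n$ and every $m$-linear form $T:\ell_\infty^n\times\cdots\times\ell_\infty^n\to\mathbb K$, \[ \Big(\sum_{j_1=1}^n\Big(\cdots\Big(\sum_{j_m=1}^n|T(e_{j_1},\dots,e_{j_m})|^{q_m}\Big)^{\frac{q_{m-1}}{q_m}}\cdots\Big)^{\frac{q_1}{q_2}}\Big)^{\frac1{q_1}}\le C\|T\|. \] For $0<q<\infty$, $A_q$ denotes the optimal constant in the lower Khinchine inequality $A_q(\sum_j|a_j|^2)^{1/2}\le (\mathbb E|\sum_j a_j\varepsilon_j|^q)^{1/q}$ for all finite scalar sequences, where for $\mathbb K=\mathbb R$ the $\varepsilon_j$ are independent Rademacher variables and for $\mathbb K=\mathbb C$ independent Steinhaus variables. Known values: for $\mathbb K=\mathbb C$, $q\in[1,2]$: $A_q=\Gamma(\frac{q+2}{2})^{1/q}$;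 for $\mathbb K=\mathbb R$: $A_q=2^{\frac12-\frac1q}$ if $q<q_0\approx1.8474$ and $A_q=\sqrt2(\Gamma(\frac{1+q}{2})/\sqrt\pi)^{1/q}$ if $q>q_0$, with $\Gamma(\frac{q_0+1}{2})=\frac{\sqrt\pi}2$. *)

(* Defs.v *)
From Stdlib Require Import Reals Lra Lia ClassicalEpsilon.
Open Scope R_scope.

(** * Scalars: K = R or C. Complex numbers are pairs (re, im);
    real scalars are the pairs with zero imaginary part. *)
Inductive field := RealF | ComplexF.

Definition C : Type := (R * R)%type.
Definition C0 : C := (0, 0).
Definition C1 : C := (1, 0).
Definition Cadd (z w : C) : C := (fst z + fst w, snd z + snd w).
Definition Cmul (z w : C) : C :=
  (fst z * fst w - snd z * snd w, fst z * snd w + snd z * fst w).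
Definition Cmod (z : C) : R := sqrt (fst z ^ 2 + snd z ^ 2).

Definition inK (K : field) (z : C) : Prop :=
  match K with RealF => snd z = 0 | ComplexF => True end.

Fixpoint rsum (n : nat) (f : nat -> R) : R :=
  match n with O => 0 | S n' => rsum n' f + f n' end.
Fixpoint rprod (n : nat) (f : nat -> R) : R :=
  match n with O => 1 | S n' => rprod n' f * f n' end.
Fixpoint csum (n : nat) (f : nat -> C) : C :=
  match n with O => C0 | S n' => Cadd (csum n' f) (f n') end.

(** x^y for x >= 0 and y > 0 (with 0^y = 0) *)
Definition rpow (x y : R) : R :=
  match Rle_dec x 0 with left _ => 0 | right _ => Rpower x y end.

Definition upd {A : Type} (f : nat -> A) (k : nat) (v : A) : nat -> A :=
  fun i => if Nat.eqb i k then v else f i.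

(** * Multilinear forms on l_infty^n x ... x l_infty^n (m factors).
    A tuple of vectors is x : nat -> nat -> C, x k j = j-th coordinate
    of the k-th vector (k < m, j < n). *)
Definition is_mlinear (K : field) (m n : nat) (T : (nat -> nat -> C) -> C) : Prop :=
  (forall x y : nat -> nat -> C,
      (forall k j, (k < m)%nat -> (j < n)%nat -> x k j = y k j) -> T x = T y) /\
  (forall (x : nat -> nat -> C) (k : nat) (c : C) (y : nat -> C),
      (forall k' j, inK K (x k' j)) -> (forall j, inK K (y j)) -> inK K c ->
      (k < m)%nat ->
      T (upd x k (fun j => Cadd (x k j) (Cmul c (y j)))) =
      Cadd (T x) (Cmul c (T (upd x k y)))) /\
  (forall x : nat -> nat -> C, (forall k j, inK K (x k j)) -> inK K (T x)).

Definition norm_set (K : field) (m n : nat) (T : (nat -> nat -> C) -> C) (r : R) : Prop :=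
  exists x : nat -> nat -> C,
    (forall k j, inK K (x k j)) /\
    (forall k j, (k < m)%nat -> (j < n)%nat -> Cmod (x k j) <= 1) /\
    r = Cmod (T x).

Definition is_opnorm (K : field) (m n : nat) (T : (nat -> nat -> C) -> C) (N : R) : Prop :=
  is_lub (norm_set K m n T) N.

Definition unitv (j : nat) : nat -> C := fun i => if Nat.eqb i j then C1 else C0.

(** mixed norm: mix n q F r k J computes, for the multi-index prefix J
    (positions < k fixed), the quantity
    (sum_{j_k} ( ... (sum_{j_(m-1)} F(J)^{q_(m-1)})^{q_(m-2)/q_(m-1)} ...)^{q_k/q_(k+1)})^{1/q_k}
    where r = m - k remaining indices (0-based: q k is the paper's q_(k+1)). *)
Fixpoint mix (n : nat) (q : nat -> R) (F : (nat -> nat) -> R)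
         (r k : nat) (J : nat -> nat) : R :=
  match r with
  | O => F J
  | S r' => rpow (rsum n (fun v => rpow (mix n q F r' (S k) (upd J k v)) (q k))) (/ q k)
  end.

Definition BH_lhs (m n : nat) (q : nat -> R) (T : (nat -> nat -> C) -> C) : R :=
  mix n q (fun J => Cmod (T (fun k => unitv (J k)))) m O (fun _ => O).

Definition BH_admissible (K : field) (m : nat) (q : nat -> R) (Cst : R) : Prop :=
  1 <= Cst /\
  forall (n : nat) (T : (nat -> nat -> C) -> C) (N : R),
    (1 <= n)%nat -> is_mlinear K m n T -> is_opnorm K m n T N ->
    BH_lhs m n q T <= Cst * N.

Definition is_BH_const (K : field) (m : nat) (q : nat -> R) (B : R) : Prop :=
  BH_admissible K m q B /\ forall Cst, BH_admissible K m q Cst -> B <= Cst.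

(** * Expectations.  Total Riemann integral (value of RiemannInt if integrable). *)
Definition RInt (f : R -> R) (a b : R) : R :=
  epsilon (inhabits 0) (fun I => exists pr : Riemann_integrable f a b, RiemannInt pr = I).

Fixpoint avg_rad (N : nat) (g : (nat -> R) -> R) : R :=
  match N with
  | O => g (fun _ => 1)
  | S N' => avg_rad N' (fun e => (g (upd e N' 1) + g (upd e N' (-1))) / 2)
  end.

Fixpoint avg_angle (N : nat) (g : (nat -> R) -> R) : R :=
  match N with
  | O => g (fun _ => 0)
  | S N' => avg_angle N' (fun th => / (2 * PI) * RInt (fun t => g (upd th N' t)) 0 (2 * PI))
  end.

Definition Expect (K : field) (N : nat) (h : (nat -> C) -> R) : R :=
  match K with
  | RealF => avg_rad N (fun e => h (fun j => (e j, 0)))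
  | ComplexF => avg_angle N (fun th => h (fun j => (cos (th j), sin (th j))))
  end.

Definition Khin_admissible (K : field) (p : R) (A : R) : Prop :=
  forall (N : nat) (a : nat -> C), (forall j, inK K (a j)) ->
    A * sqrt (rsum N (fun j => Cmod (a j) ^ 2)) <=
    rpow (Expect K N (fun eps => rpow (Cmod (csum N (fun j => Cmul (a j) (eps j)))) p)) (/ p).

Definition is_Khin_const (K : field) (p : R) (A : R) : Prop :=
  Khin_admissible K p A /\ forall A', Khin_admissible K p A' -> A' <= A.

(* Main.v *)
(* Khinchine's inequality in one variable, together with the bound for [m - 1] variables,
   controls the mixed norm with exponent 2 on one variable, summed innermost, and
   [p = 2(m-1)/m] on the others.  Minkowski's inequality moves the exponent 2 to the
   original place of that variable, for each of the [m] variables, without changing the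
   constant.  The bound on [max q_i] says exactly what is needed for [(1/q_1, ..., 1/q_m)]
   to be a convex combination, with positive weights, of these [m] endpoints, and Hölder's
   inequality for mixed norms concludes.  The case [q_k = 2m/(m+1)] for all [k] keeps the
   induction going. *)
From Stdlib Require Import Reals Lra Lia List ClassicalEpsilon FunctionalExtensionality.
From Coquelicot Require Import Coquelicot.
Require Import Defs.
Import ListNotations.
Open Scope R_scope.

(** * Finite sums and products *)

(** The hypothesis bounds the [q_k] from above, whereas a positive weight at the [i]-th endpoint
    asks for the lower bound [q_i > 2(m-1)/m]. The fixed sum of reciprocals turns one into the
    other: if every other [1/q_k] exceeds [(m^2-m-1)/(2(m-1)^2)], then [1/q_i] falls below
    [m/(2(m-1))]. Since [2(m-1)/m] is the diagonal exponent for [m-1] variables, each step consumes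
    the diagonal estimate of the previous one. There the missing variable holds a vector of random
    signs, not a unit vector; hence the induction ranges over all duplicate-free lists of positions
    and all points of the unit ball. Two obstacles are analytic. The Steinhaus expectation is an
    iterated integral whose value is unspecified off the integrable functions, so its linearity and
    monotonicity need a class stable under integrating out a coordinate: bounded Lipschitz
    functions. And the optimal constants must be shown to exist, with [A_j > 0] so that its inverse
    is meaningful; a crude Khinchine inequality, proved for both fields at once, supplies this. *)

Lemma rsum_ext n f g : (forall j, (j < n)%nat -> f j = g j) -> rsum n f = rsum n g.
Proof.
  intros H; induction n as [|n IH]; simpl; [easy|].
  rewrite IH, H; auto.
Qed.

Lemma rsum_le n f g : (forall j, (j < n)%nat -> f j <= g j) -> rsum n f <= rsum n g.
Proof.
  intros H; induction n as [|n IH]; simpl; [lra|].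
  apply Rplus_le_compat; auto.
Qed.

Lemma rsum_nonneg n f : (forall j, (j < n)%nat -> 0 <= f j) -> 0 <= rsum n f.
Proof.
  intros H; induction n as [|n IH]; simpl; [lra|].
  apply Rplus_le_le_0_compat; auto.
Qed.

Lemma rsum_scal n c f : rsum n (fun j => c * f j) = c * rsum n f.
Proof. induction n as [|n IH]; simpl; [|rewrite IH]; ring. Qed.

Lemma rsum_plus n f g : rsum n (fun j => f j + g j) = rsum n f + rsum n g.
Proof. induction n as [|n IH]; simpl; [|rewrite IH]; ring. Qed.

Lemma rsum_exchange n p f :
  rsum n (fun i => rsum p (fun j => f i j)) = rsum p (fun j => rsum n (fun i => f i j)).
Proof.
  induction n as [|n IH]; simpl.
  - induction p as [|p IHp]; simpl in *; lra.
  - rewrite IH, <- rsum_plus; easy.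
Qed.

Lemma rsum_eq_0 n f : (forall j, (j < n)%nat -> 0 <= f j) -> rsum n f = 0 ->
  forall j, (j < n)%nat -> f j = 0.
Proof.
  intros H; induction n as [|n IH]; simpl; intros H0 j Hj; [lia|].
  assert (0 <= rsum n f) by (apply rsum_nonneg; auto).
  assert (0 <= f n) by auto.
  destruct (Nat.eq_dec j n) as [->|]; [lra|].
  apply IH; auto; [lra|lia].
Qed.

(** * Sums and products indexed by a list *)

Definition lsum {I} (l : list I) (f : I -> R) : R := fold_right (fun i s => f i + s) 0 l.
Definition lprod {I} (l : list I) (f : I -> R) : R := fold_right (fun i s => f i * s) 1 l.

Section ListSums.
Context {I : Type}.
Implicit Types (l : list I) (f g : I -> R).

Lemma lsum_ext l f g : (forall i, In i l -> f i = g i) -> lsum l f = lsum l g.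
Proof.
  induction l as [|i l IH]; simpl; intros H; [easy|].
  rewrite H, IH; auto.
Qed.

Lemma lprod_ext l f g : (forall i, In i l -> f i = g i) -> lprod l f = lprod l g.
Proof.
  induction l as [|i l IH]; simpl; intros H; [easy|].
  rewrite H, IH; auto.
Qed.

Lemma lsum_scal l c f : lsum l (fun i => c * f i) = c * lsum l f.
Proof. induction l as [|i l IH]; simpl; [|rewrite IH]; ring. Qed.

Lemma lsum_plus l f g : lsum l (fun i => f i + g i) = lsum l f + lsum l g.
Proof. induction l as [|i l IH]; simpl; [|rewrite IH]; ring. Qed.

Lemma lsum_const l c : lsum l (fun _ => c) = INR (length l) * c.
Proof.
  induction l as [|i l IH]; [simpl; ring|].
  change (lsum (i :: l) (fun _ => c)) with (c + lsum l (fun _ => c)).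
  change (length (i :: l)) with (S (length l)).
  rewrite IH, S_INR; ring.
Qed.

Lemma lsum_le l f g : (forall i, In i l -> f i <= g i) -> lsum l f <= lsum l g.
Proof.
  induction l as [|i l IH]; simpl; intros H; [lra|].
  apply Rplus_le_compat; auto.
Qed.

Lemma lprod_pos l f : (forall i, In i l -> 0 < f i) -> 0 < lprod l f.
Proof.
  induction l as [|i l IH]; simpl; intros H; [lra|].
  apply Rmult_lt_0_compat; auto.
Qed.

Lemma lprod_nonneg l f : (forall i, In i l -> 0 <= f i) -> 0 <= lprod l f.
Proof.
  induction l as [|i l IH]; simpl; intros H; [lra|].
  apply Rmult_le_pos; auto.
Qed.

Lemma lprod_le l f g : (forall i, In i l -> 0 <= f i <= g i) -> lprod l f <= lprod l g.
Proof.
  induction l as [|i l IH]; simpl; intros H; [lra|].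
  apply Rmult_le_compat; [apply H; auto| |apply H; auto|auto].
  apply lprod_nonneg; intros; apply H; auto.
Qed.

Lemma lprod_mult l f g : lprod l (fun i => f i * g i) = lprod l f * lprod l g.
Proof. induction l as [|i l IH]; simpl; [|rewrite IH]; ring. Qed.

Lemma lprod_0 l f i : In i l -> f i = 0 -> lprod l f = 0.
Proof.
  induction l as [|j l IH]; simpl; [easy|].
  intros [->|Hi] H; [rewrite H|rewrite IH by auto]; ring.
Qed.

Lemma rsum_lsum n l (f : nat -> I -> R) :
  rsum n (fun v => lsum l (f v)) = lsum l (fun i => rsum n (fun v => f v i)).
Proof.
  induction l as [|i l IH]; simpl.
  - induction n as [|n IHn]; simpl; [|rewrite IHn]; ring.
  - rewrite rsum_plus, IH; easy.
Qed.
End ListSums.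

Lemma lsum_remove l i (f : nat -> R) : NoDup l -> In i l ->
  lsum l f = f i + lsum (remove Nat.eq_dec i l) f.
Proof.
  induction l as [|j l IH]; simpl; [easy|].
  intros Hnd Hi; inversion Hnd as [|? ? Hj Hl]; subst.
  destruct (Nat.eq_dec i j) as [->|Hij].
  - rewrite notin_remove; auto.
  - destruct Hi as [->|Hi]; [easy|]. simpl; rewrite IH; auto; ring.
Qed.

Lemma rsum_seq n f : rsum n f = lsum (seq 0 n) f.
Proof.
  induction n as [|n IH]; [easy|].
  rewrite seq_S; simpl; rewrite IH; unfold lsum; rewrite fold_right_app; simpl.
  generalize (seq 0 n); intros l; induction l as [|i l IHl]; simpl; [ring|].
  rewrite <- IHl; ring.
Qed.

(** * Powers of nonnegative reals *)

Lemma rpow_pos_eq x y : 0 < x -> rpow x y = Rpower x y.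
Proof. intros; unfold rpow; destruct (Rle_dec x 0); [lra|easy]. Qed.

Lemma rpow_0 y : rpow 0 y = 0.
Proof. unfold rpow; destruct (Rle_dec 0 0); [easy|lra]. Qed.

Lemma rpow_pos x y : 0 < x -> 0 < rpow x y.
Proof. intros; rewrite rpow_pos_eq by easy; apply exp_pos. Qed.

Lemma rpow_nonneg x y : 0 <= rpow x y.
Proof.
  unfold rpow; destruct (Rle_dec x 0); [lra|]. left; apply exp_pos.
Qed.

(** For [x <= 0] both sides are [0] whatever the exponents, so exponent algebra below carries no
    side conditions. *)
Lemma rpow_rpow x a b : rpow (rpow x a) b = rpow x (a * b).
Proof.
  destruct (Rle_dec x 0) as [H|H].
  - unfold rpow at 2 3; destruct (Rle_dec x 0); [|easy]. apply rpow_0.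
  - rewrite rpow_pos_eq by (apply rpow_pos; lra).
    rewrite !rpow_pos_eq by lra; apply Rpower_mult.
Qed.

Lemma rpow_plus x a b : rpow x (a + b) = rpow x a * rpow x b.
Proof.
  unfold rpow; destruct (Rle_dec x 0); [ring|]. apply Rpower_plus.
Qed.

Lemma rpow_mult_distr x y a : 0 <= x -> 0 <= y -> rpow (x * y) a = rpow x a * rpow y a.
Proof.
  intros [Hx|<-] [Hy|<-]; rewrite ?Rmult_0_l, ?Rmult_0_r, ?rpow_0; try ring.
  rewrite !rpow_pos_eq by (try apply Rmult_lt_0_compat; easy).
  unfold Rpower; rewrite ln_mult, Rmult_plus_distr_l, exp_plus; easy.
Qed.

Lemma rpow_1 x : 0 <= x -> rpow x 1 = x.
Proof.
  intros [H|<-]; [|apply rpow_0]. rewrite rpow_pos_eq by easy; apply Rpower_1; easy.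
Qed.

Lemma rpow_one_l y : rpow 1 y = 1.
Proof. rewrite rpow_pos_eq by lra; unfold Rpower; rewrite ln_1, Rmult_0_r; apply exp_0. Qed.

Lemma rpow_2 x : 0 <= x -> rpow x 2 = x ^ 2.
Proof.
  intros H; replace 2 with (1 + 1) at 1 by ring.
  rewrite rpow_plus, rpow_1 by easy; ring.
Qed.

Lemma rpow_half x : 0 <= x -> rpow x (/ 2) = sqrt x.
Proof.
  intros [H|<-]; [|rewrite sqrt_0; apply rpow_0].
  rewrite rpow_pos_eq by easy; apply Rpower_sqrt; easy.
Qed.

Lemma rpow_le x y a : 0 <= a -> 0 <= x <= y -> rpow x a <= rpow y a.
Proof.
  intros Ha [[Hx|<-] Hxy]; [|rewrite rpow_0; apply rpow_nonneg].
  rewrite !rpow_pos_eq by lra; apply Rle_Rpower_l; lra.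
Qed.

Lemma rpow_inv_r x a : a <> 0 -> 0 <= x -> rpow (rpow x a) (/ a) = x.
Proof. intros; rewrite rpow_rpow, Rinv_r, rpow_1; easy. Qed.

Lemma rpow_inv_l x a : a <> 0 -> 0 <= x -> rpow (rpow x (/ a)) a = x.
Proof. intros; rewrite rpow_rpow, Rinv_l, rpow_1; easy. Qed.

Lemma rpow_le_base_le_1 x a : 1 <= a -> 0 <= x <= 1 -> rpow x a <= x.
Proof.
  intros Ha [[Hx|<-] H1]; [|rewrite rpow_0; lra].
  rewrite rpow_pos_eq by easy.
  rewrite <- (Rpower_1 x) at 2 by easy. unfold Rpower.
  assert (ln x <= 0) by (rewrite <- ln_1; apply ln_le; lra).
  destruct (Req_dec ((a - 1) * ln x) 0); [right; f_equal; lra|].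
  left; apply exp_increasing. nra.
Qed.

(** An empty list would give [1] on the left, but [rpow x 0] is [0] at [x = 0]. *)
Lemma lprod_rpow {I} (l : list I) x w : l <> [] ->
  lprod l (fun i => rpow x (w i)) = rpow x (lsum l w).
Proof.
  destruct l as [|i l]; [easy|intros _]. revert i.
  induction l as [|j l IH]; intros i; simpl in *.
  - rewrite Rplus_0_r; ring.
  - rewrite IH, (rpow_plus x (w i)); easy.
Qed.

Lemma rpow_lprod {I} (l : list I) f a : (forall i, In i l -> 0 <= f i) ->
  rpow (lprod l f) a = lprod l (fun i => rpow (f i) a).
Proof.
  induction l as [|i l IH]; simpl; intros H; [apply rpow_one_l|].
  rewrite rpow_mult_distr, IH; auto.
  apply lprod_nonneg; auto.
Qed.

(** * Hölder and Minkowski inequalities *)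

Lemma exp_ge_1_plus x : 1 + x <= exp x.
Proof.
  destruct (Req_dec x 0) as [->|H]; [rewrite exp_0; lra|].
  left; apply exp_ineq1; easy.
Qed.

Lemma weighted_AM_GM {I} (l : list I) (w x : I -> R) :
  (forall i, In i l -> 0 < w i) -> lsum l w = 1 -> (forall i, In i l -> 0 <= x i) ->
  lprod l (fun i => rpow (x i) (w i)) <= lsum l (fun i => w i * x i).
Proof.
  intros Hw Hs Hx.
  set (M := lsum l (fun i => w i * x i)).
  assert (H0 : 0 <= M).
  { rewrite <- (Rmult_0_r (INR (length l))), <- lsum_const. apply lsum_le; intros.
    apply Rmult_le_pos; [left|]; auto. }
  destruct (classic (exists i, In i l /\ x i = 0)) as [(i & Hi & Hxi)|Hnz].
  { rewrite (lprod_0 l _ i); auto. rewrite Hxi; apply rpow_0. }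
  assert (Hpos : forall i, In i l -> 0 < x i).
  { intros i Hi; destruct (Hx i Hi); [easy|]. exfalso; apply Hnz; exists i; auto. }
  clear Hnz Hx.
  assert (HM : 0 < M).
  { destruct l as [|i l]; simpl in Hs; [lra|].
    assert (0 <= lsum l (fun i => w i * x i)).
    { rewrite <- (Rmult_0_r (INR (length l))), <- lsum_const. apply lsum_le; intros.
      apply Rmult_le_pos; left; auto with datatypes. }
    assert (0 < w i * x i) by (apply Rmult_lt_0_compat; auto with datatypes).
    unfold M; simpl; lra. }
  assert (E : lprod l (fun i => rpow (x i) (w i)) = exp (lsum l (fun i => w i * ln (x i)))).
  { clear - Hpos. induction l as [|i l IH]; simpl; [symmetry; apply exp_0|].
    rewrite exp_plus, <- IH by auto with datatypes.
    rewrite rpow_pos_eq by auto with datatypes; easy. }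
  rewrite E.
  rewrite <- (exp_ln M) by easy.
  (* Concavity of the logarithm through its tangent at [M]: weight [ln (x_i / M) <= x_i / M - 1] by
     [w_i] and sum; the right-hand sides add up to [0]. *)
  assert (L : lsum l (fun i => w i * ln (x i)) <= ln M).
  { assert (H : lsum l (fun i => w i * ln (x i)) <=
      lsum l (fun i => w i * (ln M - 1) + / M * (w i * x i))).
    { apply lsum_le; intros i Hi.
      assert (Hr : 1 + ln (x i / M) <= x i / M).
      { rewrite <- (exp_ln (x i / M)) at 2 by (apply Rdiv_lt_0_compat; auto).
        apply exp_ge_1_plus. }
      unfold Rdiv in Hr; rewrite ln_mult, ln_Rinv in Hr; auto using Rinv_0_lt_compat.
      specialize (Hw i Hi). nra. }
    rewrite lsum_plus, lsum_scal in H. fold M in H.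
    rewrite (lsum_ext l (fun i => w i * (ln M - 1)) (fun i => (ln M - 1) * w i)) in H
      by (intros; ring).
    rewrite lsum_scal, Hs, Rinv_l in H; lra. }
  destruct L as [L|L]; [left; apply exp_increasing; easy|right; rewrite L; easy].
Qed.

(** After normalising each sum to [1], the weighted AM-GM inequality at every [v] sums to the claim.
    If some sum is [0], all its terms vanish and so does the left-hand side. *)
Lemma Holder {I} n (l : list I) (w : I -> R) (a : I -> nat -> R) :
  (forall i, In i l -> 0 < w i) -> lsum l w = 1 ->
  (forall i v, In i l -> (v < n)%nat -> 0 <= a i v) ->
  rsum n (fun v => lprod l (fun i => rpow (a i v) (w i))) <=
  lprod l (fun i => rpow (rsum n (a i)) (w i)).
Proof.
  intros Hw Hs Ha.
  assert (HS : forall i, In i l -> 0 <= rsum n (a i)).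
  { intros; apply rsum_nonneg; auto. }
  destruct (classic (exists i, In i l /\ rsum n (a i) = 0)) as [(i & Hi & H0)|Hnz].
  { rewrite (rsum_ext n _ (fun v => 0 * 0)).
    - rewrite rsum_scal, Rmult_0_l. apply lprod_nonneg; intros; apply rpow_nonneg.
    - intros v Hv. rewrite (lprod_0 l _ i); [ring|easy|].
      rewrite (rsum_eq_0 n (a i)); auto using rpow_0. }
  assert (HP : forall i, In i l -> 0 < rsum n (a i)).
  { intros i Hi; destruct (HS i Hi); [easy|]. exfalso; apply Hnz; exists i; auto. }
  set (D := lprod l (fun i => rpow (rsum n (a i)) (w i))).
  assert (HD : 0 < D) by (apply lprod_pos; auto using rpow_pos).
  apply Rle_trans with
    (rsum n (fun v => D * lsum l (fun i => w i * (a i v / rsum n (a i))))).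
  - apply rsum_le; intros v Hv.
    rewrite (lprod_ext l _ (fun i => rpow (rsum n (a i)) (w i) *
      rpow (a i v / rsum n (a i)) (w i))).
    + rewrite lprod_mult. apply Rmult_le_compat_l; [left; easy|].
      apply weighted_AM_GM; auto. intros; apply Rle_mult_inv_pos; auto.
    + intros i Hi. rewrite <- rpow_mult_distr; auto; [f_equal; field|].
      * apply Rgt_not_eq, HP; easy.
      * apply Rle_mult_inv_pos; auto.
  - rewrite rsum_scal, rsum_lsum.
    rewrite (lsum_ext l _ w); [rewrite Hs; lra|].
    intros i Hi.
    rewrite (rsum_ext n _ (fun v => (w i / rsum n (a i)) * a i v)) by (intros; unfold Rdiv; ring).
    rewrite rsum_scal; field. apply Rgt_not_eq, HP; easy.
Qed.

(** Write [b^s = b b^(s-1)] with [b] the inner sum, exchange the sums and apply Hölder for each [w];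
    this gives [X <= D X^(1-1/s)], to be divided by [X^(1-1/s)] when [X > 0]. *)
Lemma Minkowski n p s (a : nat -> nat -> R) : 1 < s -> (forall v w, 0 <= a v w) ->
  rpow (rsum n (fun v => rpow (rsum p (a v)) s)) (/ s) <=
  rsum p (fun w => rpow (rsum n (fun v => rpow (a v w) s)) (/ s)).
Proof.
  intros Hs Ha.
  set (b := fun v => rsum p (a v)).
  change (fun v => rpow (rsum p (a v)) s) with (fun v => rpow (b v) s).
  assert (Hb : forall v, 0 <= b v) by (intros; apply rsum_nonneg; auto).
  set (X := rsum n (fun v => rpow (b v) s)).
  set (D := rsum p (fun w => rpow (rsum n (fun v => rpow (a v w) s)) (/ s))).
  assert (HD : 0 <= D) by (apply rsum_nonneg; intros; apply rpow_nonneg).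
  assert (HX : 0 <= X) by (apply rsum_nonneg; intros; apply rpow_nonneg).
  assert (His : 0 < / s < 1).
  { split; [apply Rinv_0_lt_compat; lra|]. rewrite <- Rinv_1; apply Rinv_lt_contravar; lra. }
  assert (HXD : X <= D * rpow X (1 - / s)).
  { apply Rle_trans with (rsum n (fun v => rsum p (fun w => a v w * rpow (b v) (s - 1)))).
    - apply rsum_le; intros v _.
      rewrite (rsum_ext p _ (fun w => rpow (b v) (s - 1) * a v w)) by (intros; ring).
      rewrite rsum_scal. fold (b v).
      replace s with ((s - 1) + 1) at 1 by ring. rewrite rpow_plus, rpow_1 by auto. lra.
    - rewrite rsum_exchange. unfold D. rewrite Rmult_comm, <- rsum_scal.
      apply rsum_le; intros w _.
      pose proof (Holder n [true; false] (fun c : bool => if c then / s else 1 - / s)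
        (fun (c : bool) v => if c then rpow (a v w) s else rpow (b v) s)) as H.
      simpl in H. fold X in H. rewrite Rmult_1_r in H.
      rewrite Rmult_comm. eapply Rle_trans; [|apply H].
      + apply rsum_le; intros v _. rewrite !rpow_rpow, Rmult_1_r, Rinv_r, rpow_1 by (auto; lra).
        right; f_equal; f_equal; field; lra.
      + intros [|] _; lra.
      + ring.
      + intros [|] v _ _; apply rpow_nonneg. }
  destruct HX as [HX|HX]; [|rewrite <- HX, rpow_0; easy].
  apply Rmult_le_reg_r with (rpow X (1 - / s)); [apply rpow_pos; easy|].
  rewrite <- rpow_plus. replace (/ s + (1 - / s)) with 1 by ring.
  rewrite rpow_1; lra.
Qed.

(** * Mixed norms over a list of positions *)

Notation tuple := (nat -> nat -> C).

(* The state is the tuple of arguments itself: summing over [j_k] replaces the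
   [k]-th argument by unit vectors, the positions outside [l] keep arbitrary vectors. *)
Fixpoint mixl (n : nat) (p : nat -> R) (l : list nat) (H : tuple -> R) (x : tuple) : R :=
  match l with
  | [] => H x
  | k :: l' => rpow (rsum n (fun v => rpow (mixl n p l' H (upd x k (unitv v))) (p k))) (/ p k)
  end.

(** Flat sums commute with expectations, nested powers do not; a mixed norm with a single exponent
    is reduced to a flat sum before randomisation. *)
Fixpoint msum (n : nat) (l : list nat) (H : tuple -> R) (x : tuple) : R :=
  match l with
  | [] => H x
  | k :: l' => rsum n (fun v => msum n l' H (upd x k (unitv v)))
  end.

Lemma upd_eq {A} (x : nat -> A) k a : upd x k a k = a.
Proof. unfold upd; rewrite Nat.eqb_refl; easy. Qed.

Lemma upd_neq {A} (x : nat -> A) k a j : j <> k -> upd x k a j = x j.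
Proof. intros H; unfold upd; apply Nat.eqb_neq in H; rewrite H; easy. Qed.

Lemma upd_comm {A} (x : nat -> A) i k a b : i <> k ->
  upd (upd x i a) k b = upd (upd x k b) i a.
Proof.
  intros H; apply functional_extensionality; intros j; unfold upd.
  destruct (Nat.eqb_spec j k), (Nat.eqb_spec j i); congruence.
Qed.

Lemma upd_twice {A} (x : nat -> A) k a b : upd (upd x k a) k b = upd x k b.
Proof.
  apply functional_extensionality; intros j; unfold upd; destruct (Nat.eqb j k); easy.
Qed.

Lemma mixl_nonneg n p l H x : (forall y, 0 <= H y) -> 0 <= mixl n p l H x.
Proof. intros; destruct l; simpl; [easy|apply rpow_nonneg]. Qed.

Lemma mixl_app n p l1 l2 H x : mixl n p (l1 ++ l2) H x = mixl n p l1 (mixl n p l2 H) x.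
Proof.
  revert x; induction l1 as [|k l1 IH]; intros x; simpl; [easy|].
  f_equal; apply rsum_ext; intros; rewrite IH; easy.
Qed.

Lemma mixl_ext_exp n p p' l H x : (forall k, In k l -> p k = p' k) ->
  mixl n p l H x = mixl n p' l H x.
Proof.
  revert x; induction l as [|k l IH]; intros x Hp; simpl; [easy|].
  rewrite Hp by auto with datatypes. f_equal; apply rsum_ext; intros; rewrite IH; auto with datatypes.
Qed.

Lemma mixl_le n p l H H' x : (forall k, In k l -> 0 < p k) ->
  (forall y, 0 <= H y <= H' y) -> mixl n p l H x <= mixl n p l H' x.
Proof.
  intros Hp HH; revert x; induction l as [|k l IH]; intros x; simpl; [apply HH|].
  assert (0 < p k) by auto with datatypes.
  apply rpow_le; [left; apply Rinv_0_lt_compat; easy|]. split.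
  - apply rsum_nonneg; intros; apply rpow_nonneg.
  - apply rsum_le; intros; apply rpow_le; [lra|]. split.
    + apply mixl_nonneg; apply HH.
    + apply IH; auto with datatypes.
Qed.

Lemma mixl_const n c l H x : 0 < c -> (forall y, 0 <= H y) ->
  mixl n (fun _ => c) l H x = rpow (msum n l (fun y => rpow (H y) c) x) (/ c).
Proof.
  intros Hc HH; revert x; induction l as [|k l IH]; intros x; simpl.
  - rewrite rpow_inv_r; auto; lra.
  - f_equal; apply rsum_ext; intros v _. rewrite IH, rpow_inv_l; [easy|lra|].
    generalize (upd x k (unitv v)); clear - HH.
    induction l as [|k l IH]; intros y; simpl; [apply rpow_nonneg|].
    apply rsum_nonneg; auto.
Qed.

(** Induction on the positions: the outermost sum meets a product of inner norms, and Hölder splits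
    it. The condition on [/ q k] makes the Hölder weights [q_k t_i / p_(i,k)] sum to [1]. *)
Lemma mixl_interpolation {I} n (L : list I) (t : I -> R) (p : I -> nat -> R) q l H x :
  (forall y, 0 <= H y) ->
  (forall i, In i L -> 0 < t i) -> lsum L t = 1 ->
  (forall k, In k l -> 0 < q k) ->
  (forall i k, In i L -> In k l -> 0 < p i k) ->
  (forall k, In k l -> / q k = lsum L (fun i => t i * / p i k)) ->
  mixl n q l H x <= lprod L (fun i => rpow (mixl n (p i) l H x) (t i)).
Proof.
  intros HH Ht Hs; revert x; induction l as [|k l IH]; intros x Hq Hp Hqp; simpl.
  - rewrite lprod_rpow, Hs, rpow_1; auto; [lra|].
    intros ->; simpl in Hs; lra.
  - assert (Hqk : 0 < q k) by auto with datatypes.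
    set (G := fun i v => mixl n (p i) l H (upd x k (unitv v))).
    apply Rle_trans with (rpow (rsum n (fun v => lprod L (fun i =>
        rpow (rpow (G i v) (p i k)) (q k * (t i * / p i k))))) (/ q k)).
    + apply rpow_le; [left; apply Rinv_0_lt_compat; easy|]. split.
      { apply rsum_nonneg; intros; apply rpow_nonneg. }
      apply rsum_le; intros v _.
      apply Rle_trans with (rpow (lprod L (fun i => rpow (G i v) (t i))) (q k)).
      * apply rpow_le; [lra|]. split; [apply mixl_nonneg; easy|].
        apply IH; auto with datatypes.
      * rewrite rpow_lprod by (intros; apply rpow_nonneg).
        right; apply lprod_ext; intros i Hi. rewrite !rpow_rpow; f_equal.
        field. apply Rgt_not_eq, Hp; auto with datatypes.
    + eapply Rle_trans; [apply rpow_le; [left; apply Rinv_0_lt_compat; easy|split]|].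
      * apply rsum_nonneg; intros; apply lprod_nonneg; intros; apply rpow_nonneg.
      * apply (Holder n L (fun i => q k * (t i * / p i k)) (fun i v => rpow (G i v) (p i k))).
        -- intros i Hi. repeat apply Rmult_lt_0_compat; auto.
           apply Rinv_0_lt_compat; auto with datatypes.
        -- rewrite lsum_scal, <- Hqp by auto with datatypes. field; lra.
        -- intros; apply rpow_nonneg.
      * rewrite rpow_lprod by (intros; apply rpow_nonneg).
        right; apply lprod_ext; intros i Hi. rewrite !rpow_rpow; f_equal.
        field. split; [|lra]. apply Rgt_not_eq, Hp; auto with datatypes.
Qed.

(** Minkowski with [s = p_i / p_k > 1], applied to the [p_k]-th powers of the inner norms, followed
    by a [p_k]-th root. Moving the larger exponent inwards increases the norm. *)
Lemma mixl_swap n p i k l H x : i <> k -> 0 < p k < p i -> (forall y, 0 <= H y) ->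
  mixl n p (i :: k :: l) H x <= mixl n p (k :: i :: l) H x.
Proof.
  intros Hik Hp HH; simpl.
  set (G := fun v w => mixl n p l H (upd (upd x i (unitv v)) k (unitv w))).
  assert (HG : forall v w, 0 <= G v w) by (intros; apply mixl_nonneg; easy).
  assert (Hk : 0 <= / p k) by (left; apply Rinv_0_lt_compat; lra).
  set (s := p i / p k).
  assert (Hs : 1 < s).
  { unfold s; apply Rmult_lt_reg_r with (p k); [lra|]. field_simplify; lra. }
  pose proof (Minkowski n n s (fun v w => rpow (G v w) (p k)) Hs
    (fun v w => rpow_nonneg _ _)) as HM.
  apply (fun H => rpow_le _ _ (/ p k) H (conj (rpow_nonneg _ _) HM)) in Hk.
  clear HM; rename Hk into HM; rewrite rpow_rpow in HM.
  match type of HM with ?a <= ?b => match goal with |- ?c <= ?d =>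
    replace c with a; [replace d with b; [exact HM|]|] end end.
  - f_equal; apply rsum_ext; intros w _. rewrite rpow_rpow.
    replace (/ p i * p k) with (/ s) by (unfold s; field; lra). f_equal.
    apply rsum_ext; intros v _. rewrite rpow_rpow, upd_comm by congruence.
    unfold G; f_equal. unfold s; field; lra.
  - replace (/ s * / p k) with (/ p i) by (unfold s; field; lra). f_equal.
    apply rsum_ext; intros v _. rewrite rpow_rpow. f_equal. unfold s; field; lra.
Qed.

Lemma mixl_move_last n p i l H x : ~ In i l -> (forall k, In k l -> 0 < p k < p i) ->
  0 < p i -> (forall y, 0 <= H y) ->
  mixl n p (i :: l) H x <= mixl n p (l ++ [i]) H x.
Proof.
  intros Hi Hp Hpi HH; revert x; induction l as [|k l IH]; intros x; [simpl; lra|].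
  eapply Rle_trans; [apply mixl_swap; auto with datatypes|].
  - intros ->; auto with datatypes.
  - apply (mixl_le n p [k] (mixl n p (i :: l) H) (mixl n p (l ++ [i]) H)).
    + intros j [<-|[]]. apply Hp; auto with datatypes.
    + intros y; split; [apply mixl_nonneg; easy|]. apply IH; auto with datatypes.
Qed.

(** [P] is an invariant under inserting unit vectors: the comparisons it serves hold only at tuples
    with coordinates in the scalar field. *)
Lemma msum_le n l (P : tuple -> Prop) f g x :
  (forall y k v, P y -> P (upd y k (unitv v))) -> (forall y, P y -> f y <= g y) -> P x ->
  msum n l f x <= msum n l g x.
Proof.
  intros HP Hfg; revert x; induction l as [|k l IH]; intros x Hx; simpl; [auto|].
  apply rsum_le; auto.
Qed.

Lemma msum_scal n l c f x : msum n l (fun y => c * f y) x = c * msum n l f x.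
Proof.
  revert x; induction l as [|k l IH]; intros x; simpl; [easy|].
  rewrite <- rsum_scal; apply rsum_ext; auto.
Qed.

Lemma msum_upd n l i z f x : ~ In i l ->
  msum n l (fun y => f (upd y i z)) x = msum n l f (upd x i z).
Proof.
  revert x; induction l as [|k l IH]; intros x Hi; simpl; [easy|].
  apply rsum_ext; intros v _. rewrite IH by auto with datatypes.
  rewrite upd_comm; auto with datatypes. intros ->; auto with datatypes.
Qed.

Lemma msum_nonneg n l f x : (forall y, 0 <= f y) -> 0 <= msum n l f x.
Proof.
  intros Hf; revert x; induction l as [|k l IH]; intros y; simpl; [easy|].
  apply rsum_nonneg; auto.
Qed.

Lemma mix_mixl n q T r k J :
  mix n q (fun J => Cmod (T (fun i => unitv (J i)))) r k J =
  mixl n q (seq k r) (fun x => Cmod (T x)) (fun i => unitv (J i)).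
Proof.
  revert k J; induction r as [|r IH]; intros k J; simpl; [easy|].
  f_equal; apply rsum_ext; intros v _. rewrite IH. do 2 f_equal.
  apply functional_extensionality; intros i. unfold upd; destruct (Nat.eqb i k); easy.
Qed.

(** * Averages over Rademacher and Steinhaus variables *)

(** Both laws are parametrised by a real number, the sign itself or the angle, so that one set of
    averaging lemmas serves both fields. *)
Definition phase (K : field) (t : R) : C :=
  match K with RealF => (t, 0) | ComplexF => (cos t, sin t) end.

Definition valid (K : field) (t : R) : Prop :=
  match K with RealF => t = 1 \/ t = -1 | ComplexF => True end.

Definition mean (K : field) (f : R -> R) : R :=
  match K with
  | RealF => (f 1 + f (-1)) / 2
  | ComplexF => / (2 * PI) * Defs.RInt f 0 (2 * PI)
  end.

Fixpoint avg (K : field) (N : nat) (g : (nat -> R) -> R) : R :=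
  match N with
  | O => g (fun _ => match K with RealF => 1 | ComplexF => 0 end)
  | S N' => avg K N' (fun th => mean K (fun t => g (upd th N' t)))
  end.

Lemma Expect_avg K N h : Expect K N h = avg K N (fun th => h (fun j => phase K (th j))).
Proof.
  destruct K; simpl.
  - generalize (fun e : nat -> R => h (fun j => (e j, 0))).
    induction N as [|N IH]; intros g; simpl; [easy|]. apply IH.
  - generalize (fun th : nat -> R => h (fun j => (cos (th j), sin (th j)))).
    induction N as [|N IH]; intros g; simpl; [easy|]. apply IH.
Qed.

Lemma valid_phase K t : valid K t ->
  inK K (phase K t) /\ fst (phase K t) ^ 2 + snd (phase K t) ^ 2 = 1.
Proof.
  destruct K; simpl.
  - intros [->| ->]; split; lra.
  - intros _; split; [easy|]. pose proof (sin2_cos2 t); unfold Rsqr in *; lra.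
Qed.

(* Boundedness is recorded along with the Lipschitz bound so that the class is closed
   under products. Rademacher averages are finite sums and need no regularity. *)
Definition nice (K : field) (N : nat) (g : (nat -> R) -> R) : Prop :=
  match K with
  | RealF => True
  | ComplexF => exists L M, 0 <= L /\ (forall th, Rabs (g th) <= M) /\
      forall th th', Rabs (g th - g th') <= L * rsum N (fun j => Rabs (th j - th' j))
  end.

Definition nice1 (K : field) (f : R -> R) : Prop :=
  match K with
  | RealF => True
  | ComplexF => exists L, forall t t', Rabs (f t - f t') <= L * Rabs (t - t')
  end.

Lemma dist_nonneg N (th th' : nat -> R) : 0 <= rsum N (fun j => Rabs (th j - th' j)).
Proof. apply rsum_nonneg; intros; apply Rabs_pos. Qed.

Lemma nice_const K N c : nice K N (fun _ => c).
Proof.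
  destruct K; simpl; [easy|]. exists 0, (Rabs c); split; [lra|split]; intros; [lra|].
  rewrite Rminus_diag, Rabs_R0; lra.
Qed.

Lemma nice_plus K N f g : nice K N f -> nice K N g -> nice K N (fun th => f th + g th).
Proof.
  destruct K; simpl; [easy|].
  intros (L & M & HL & HM & H) (L' & M' & HL' & HM' & H').
  exists (L + L'), (M + M'); split; [lra|split]; intros.
  - eapply Rle_trans; [apply Rabs_triang|]. apply Rplus_le_compat; auto.
  - replace (f th + g th - (f th' + g th')) with ((f th - f th') + (g th - g th')) by ring.
    eapply Rle_trans; [apply Rabs_triang|]. rewrite Rmult_plus_distr_r.
    apply Rplus_le_compat; auto.
Qed.

Lemma nice_mult K N f g : nice K N f -> nice K N g -> nice K N (fun th => f th * g th).
Proof.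
  destruct K; simpl; [easy|].
  intros (L & M & HL & HM & H) (L' & M' & HL' & HM' & H').
  assert (H0 : forall th, 0 <= M) by (intros th; eapply Rle_trans; [apply Rabs_pos|apply (HM th)]).
  assert (H0' : forall th, 0 <= M') by (intros th; eapply Rle_trans; [apply Rabs_pos|apply (HM' th)]).
  specialize (H0 (fun _ => 0)); specialize (H0' (fun _ => 0)).
  exists (L * M' + M * L'), (M * M'); split; [|split]; intros.
  - assert (0 <= L * M') by (apply Rmult_le_pos; easy).
    assert (0 <= M * L') by (apply Rmult_le_pos; easy). lra.
  - rewrite Rabs_mult; apply Rmult_le_compat; auto using Rabs_pos.
  - replace (f th * g th - f th' * g th') with
      ((f th - f th') * g th + f th' * (g th - g th')) by ring.
    eapply Rle_trans; [apply Rabs_triang|]. rewrite !Rabs_mult.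
    specialize (H th th'); specialize (H' th th').
    pose proof (dist_nonneg N th th'). set (d := rsum _ _) in *.
    assert (Rabs (f th - f th') * Rabs (g th) <= (L * d) * M')
      by (apply Rmult_le_compat; auto using Rabs_pos).
    assert (Rabs (f th') * Rabs (g th - g th') <= M * (L' * d))
      by (apply Rmult_le_compat; auto using Rabs_pos).
    lra.
Qed.

Lemma nice_scal K N c f : nice K N f -> nice K N (fun th => c * f th).
Proof. intros; apply nice_mult; auto using nice_const. Qed.

Lemma nice_rsum K N n (f : nat -> (nat -> R) -> R) :
  (forall v, nice K N (f v)) -> nice K N (fun th => rsum n (fun v => f v th)).
Proof.
  intros H; induction n as [|n IH]; simpl; [apply nice_const|].
  apply nice_plus; auto.
Qed.

(** The recorded bounds confine [f] and [g] to a square, so [F] need only be bounded and Lipschitz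
    on bounded sets; a power of the modulus with exponent above [1] is not globally Lipschitz. *)
Lemma nice_compose2 N f g (F : R -> R -> R) :
  (forall M, exists L B, 0 <= L /\ forall u w u' w',
    Rabs u <= M -> Rabs w <= M -> Rabs u' <= M -> Rabs w' <= M ->
    Rabs (F u w) <= B /\ Rabs (F u w - F u' w') <= L * (Rabs (u - u') + Rabs (w - w'))) ->
  nice ComplexF N f -> nice ComplexF N g -> nice ComplexF N (fun th => F (f th) (g th)).
Proof.
  intros HF (L & M & HL & HM & H) (L' & M' & HL' & HM' & H').
  destruct (HF (Rmax M M')) as (L0 & B & HL0 & HB).
  assert (Hf : forall th, Rabs (f th) <= Rmax M M')
    by (intros; eapply Rle_trans; [apply HM|apply Rmax_l]).
  assert (Hg : forall th, Rabs (g th) <= Rmax M M')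
    by (intros; eapply Rle_trans; [apply HM'|apply Rmax_r]).
  exists (L0 * (L + L')), B; split; [apply Rmult_le_pos; lra|split]; intros.
  - apply (HB _ _ (f th) (g th)); auto.
  - destruct (HB (f th) (g th) (f th') (g th')) as [_ HH]; auto.
    eapply Rle_trans; [apply HH|]. rewrite Rmult_assoc.
    apply Rmult_le_compat_l; [easy|]. specialize (H th th'); specialize (H' th th'); lra.
Qed.

Lemma Rabs_sin_le x : Rabs (sin x) <= Rabs x.
Proof.
  assert (H : forall y, 0 <= y -> Rabs (sin y) <= y).
  { intros y [Hy|<-]; [|rewrite sin_0, Rabs_R0; lra].
    destruct (Rle_dec y PI) as [Hp|Hp].
    - rewrite Rabs_pos_eq by (apply sin_ge_0; lra). left; apply sin_lt_x; easy.
    - pose proof PI2_1. pose proof (SIN_bound y). apply Rabs_le; lra. }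
  destruct (Rle_dec 0 x).
  - rewrite (Rabs_pos_eq x) by easy; auto.
  - rewrite <- Rabs_Ropp, <- sin_neg, (Rabs_left x) by lra. apply H; lra.
Qed.

Lemma sin_lipschitz a b : Rabs (sin a - sin b) <= Rabs (a - b).
Proof.
  rewrite form4, !Rabs_mult, (Rabs_pos_eq 2) by lra.
  pose proof (Rabs_sin_le ((a - b) / 2)) as H.
  unfold Rdiv in H; rewrite (Rabs_mult (a - b)), (Rabs_pos_eq (/ 2)) in H by lra.
  pose proof (COS_bound ((a + b) / 2)).
  assert (Rabs (cos ((a + b) / 2)) <= 1) by (apply Rabs_le; lra).
  assert (Rabs (cos ((a + b) / 2)) * Rabs (sin ((a - b) / 2)) <= 1 * (Rabs (a - b) * / 2))
    by (apply Rmult_le_compat; auto using Rabs_pos).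
  lra.
Qed.

Lemma cos_lipschitz a b : Rabs (cos a - cos b) <= Rabs (a - b).
Proof.
  rewrite <- !sin_shift. eapply Rle_trans; [apply sin_lipschitz|].
  replace (PI / 2 - a - (PI / 2 - b)) with (- (a - b)) by ring.
  rewrite Rabs_Ropp; lra.
Qed.

Lemma nice_coord K N j (f : C -> R) : (j < N)%nat -> f = fst \/ f = snd ->
  nice K N (fun th => f (phase K (th j))).
Proof.
  intros Hj Hf; destruct K; simpl; [easy|].
  exists 1, 1; split; [lra|split].
  - intros th; destruct Hf as [-> | ->]; simpl; apply Rabs_le;
      [apply COS_bound|apply SIN_bound].
  - intros th th'. apply Rle_trans with (Rabs (th j - th' j)).
    + destruct Hf as [-> | ->]; simpl; [apply cos_lipschitz|apply sin_lipschitz].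
    + rewrite Rmult_1_l. clear Hf; induction N as [|N IH]; simpl; [lia|].
      destruct (Nat.eq_dec j N) as [->|].
      * pose proof (dist_nonneg N th th'); lra.
      * pose proof (Rabs_pos (th N - th' N)). assert (Hj' : (j < N)%nat) by lia.
        specialize (IH Hj'); lra.
Qed.

Lemma nice1_integrable f a b : nice1 ComplexF f -> ex_RInt f a b.
Proof.
  intros (L & HL). apply (ex_RInt_continuous (V := R_CompleteNormedModule)); intros z _.
  apply continuity_pt_filterlim. intros e He.
  assert (H0 : 0 <= Rabs L) by apply Rabs_pos.
  (* [nice1] puts no sign on [L]; [Rabs L + 1] is a positive Lipschitz constant. *)
  exists (e / (Rabs L + 1)); split; [apply Rdiv_lt_0_compat; lra|].
  simpl; unfold R_dist; intros x [_ Hx].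
  eapply Rle_lt_trans; [apply HL|].
  apply Rle_lt_trans with ((Rabs L + 1) * Rabs (x - z)).
  - pose proof (Rle_abs L); apply Rmult_le_compat_r; [apply Rabs_pos|lra].
  - apply Rmult_lt_reg_l with (/ (Rabs L + 1)); [apply Rinv_0_lt_compat; lra|].
    rewrite <- Rmult_assoc, Rinv_l, Rmult_1_l by lra. unfold Rdiv in Hx; lra.
Qed.

(** Choice may pick the value attached to any proof of integrability; all of them equal the
    Coquelicot integral. *)
Lemma RInt_Defs f a b : ex_RInt f a b -> Defs.RInt f a b = Coquelicot.RInt.RInt f a b.
Proof.
  intros H. apply ex_RInt_Reals_0 in H as pr.
  unfold Defs.RInt.
  destruct (epsilon_spec (inhabits 0)
    (fun I => exists pr : Riemann_integrable f a b, RiemannInt pr = I)) as [pr' <-].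
  - exists (RiemannInt pr), pr; easy.
  - symmetry; apply RInt_Reals.
Qed.

(** * Averaging over one random parameter *)

Lemma mean_ext K f g : (forall t, valid K t -> f t = g t) -> mean K f = mean K g.
Proof.
  destruct K; simpl; intros H; [rewrite !H; auto|].
  replace g with f; [easy|]. apply functional_extensionality; auto.
Qed.

Lemma mean_complex f : nice1 ComplexF f ->
  mean ComplexF f = / (2 * PI) * Coquelicot.RInt.RInt f 0 (2 * PI).
Proof. intros; simpl; rewrite RInt_Defs; [easy|apply nice1_integrable; easy]. Qed.

Lemma inv_2PI_pos : 0 < / (2 * PI).
Proof. apply Rinv_0_lt_compat; pose proof PI_RGT_0; lra. Qed.

Lemma mean_le K f g : nice1 K f -> nice1 K g -> (forall t, valid K t -> f t <= g t) ->
  mean K f <= mean K g.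
Proof.
  destruct K; intros Hf Hg H.
  - simpl in *. pose proof (H 1); pose proof (H (-1)); lra.
  - rewrite !mean_complex by easy. pose proof inv_2PI_pos. pose proof PI_RGT_0.
    apply Rmult_le_compat_l; [lra|].
    apply RInt_le; [lra|apply nice1_integrable; easy|apply nice1_integrable; easy|].
    intros; apply H; easy.
Qed.

Lemma nice1_plus K f g : nice1 K f -> nice1 K g -> nice1 K (fun t => f t + g t).
Proof.
  destruct K; simpl; [easy|]. intros (L & HL) (L' & HL'). exists (L + L'); intros.
  replace (f t + g t - (f t' + g t')) with ((f t - f t') + (g t - g t')) by ring.
  eapply Rle_trans; [apply Rabs_triang|]. rewrite Rmult_plus_distr_r.
  apply Rplus_le_compat; auto.
Qed.

Lemma nice1_scal K c f : nice1 K f -> nice1 K (fun t => c * f t).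
Proof.
  destruct K; simpl; [easy|]. intros (L & HL). exists (Rabs c * L); intros.
  rewrite <- Rmult_minus_distr_l, Rabs_mult, Rmult_assoc.
  apply Rmult_le_compat_l; [apply Rabs_pos|easy].
Qed.

Lemma mean_plus K f g : nice1 K f -> nice1 K g ->
  mean K (fun t => f t + g t) = mean K f + mean K g.
Proof.
  destruct K; intros Hf Hg; [simpl; lra|].
  rewrite !mean_complex; auto; [|apply nice1_plus; easy].
  rewrite <- Rmult_plus_distr_l. f_equal.
  apply (RInt_plus f g); apply nice1_integrable; easy.
Qed.

Lemma mean_scal K c f : nice1 K f -> mean K (fun t => c * f t) = c * mean K f.
Proof.
  destruct K; intros Hf; [simpl; lra|].
  rewrite !mean_complex; auto; [|apply nice1_scal; easy].
  transitivity (/ (2 * PI) * (c * Coquelicot.RInt.RInt f 0 (2 * PI))); [f_equal|ring].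
  apply (RInt_scal f 0 (2 * PI) c); apply nice1_integrable; easy.
Qed.

Lemma nice1_const K c : nice1 K (fun _ => c).
Proof.
  destruct K; simpl; [easy|]. exists 0; intros. rewrite Rminus_diag, Rabs_R0; lra.
Qed.

Lemma mean_const K c : mean K (fun _ => c) = c.
Proof.
  destruct K; [simpl; lra|].
  rewrite mean_complex by apply (nice1_const ComplexF).
  rewrite RInt_const. unfold scal; simpl; unfold mult; simpl.
  field. apply PI_neq0.
Qed.

Lemma nice1_phase K (f : C -> R) : f = fst \/ f = snd -> nice1 K (fun t => f (phase K t)).
Proof.
  intros Hf; destruct K; simpl; [easy|]. exists 1; intros; rewrite Rmult_1_l.
  destruct Hf as [-> | ->]; simpl; [apply cos_lipschitz|apply sin_lipschitz].
Qed.

Lemma mean_phase K (f : C -> R) : f = fst \/ f = snd -> mean K (fun t => f (phase K t)) = 0.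
Proof.
  intros Hf. destruct K; [simpl; destruct Hf as [-> | ->]; simpl; lra|].
  rewrite mean_complex by (apply (nice1_phase ComplexF); easy).
  apply Rmult_eq_0_compat_l. apply is_RInt_unique.
  destruct Hf as [-> | ->]; simpl.
  - replace 0 with (minus (sin (2 * PI)) (sin 0)) at 2
      by (rewrite sin_2PI, sin_0; unfold minus, plus, opp; simpl; ring).
    apply (is_RInt_derive sin cos).
    + intros; auto_derive; [easy|ring].
    + intros; apply continuity_pt_filterlim, continuity_cos.
  - replace 0 with (minus ((fun x => - cos x) (2 * PI)) ((fun x => - cos x) 0)) at 2
      by (rewrite cos_2PI, cos_0; unfold minus, plus, opp; simpl; ring).
    apply (is_RInt_derive (fun x => - cos x) sin).
    + intros; auto_derive; [easy|ring].
    + intros; apply continuity_pt_filterlim, continuity_sin.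
Qed.

(** This centring is the only fact about the two laws, besides [|phase| = 1], that the moment
    estimates use. *)
Lemma mean_affine K c u w :
  mean K (fun t => c + (u * fst (phase K t) + w * snd (phase K t))) = c.
Proof.
  assert (H1 : nice1 K (fun t => fst (phase K t))) by (apply nice1_phase; auto).
  assert (H2 : nice1 K (fun t => snd (phase K t))) by (apply nice1_phase; auto).
  rewrite mean_plus, mean_const, mean_plus, !mean_scal; auto using nice1_const, nice1_plus, nice1_scal.
  rewrite (mean_phase K fst), (mean_phase K snd) by auto. ring.
Qed.

Lemma nice_slice K N g th : nice K (S N) g -> nice1 K (fun t => g (upd th N t)).
Proof.
  destruct K; simpl; [easy|]. intros (L & M & _ & _ & H). exists L; intros t t'.
  eapply Rle_trans; [apply H|]. right; f_equal. rewrite !upd_eq.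
  rewrite (rsum_ext N _ (fun _ => 0 * 0)), rsum_scal; [ring|].
  intros j Hj; rewrite !upd_neq by lia. rewrite Rminus_diag, Rabs_R0; ring.
Qed.

(** The Lipschitz estimate holds for each fixed [t] before averaging, so [L] and [M] both survive.
    Every inner integral of the iterated average is thereby integrable in the next variable. *)
Lemma nice_mean K N g : nice K (S N) g -> nice K N (fun th => mean K (fun t => g (upd th N t))).
Proof.
  intros Hn. assert (Hs : forall th, nice1 K (fun t => g (upd th N t)))
    by (intros; apply nice_slice; easy).
  destruct K; [easy|]. destruct Hn as (L & M & HL & HM & H).
  assert (HA : forall th c, (forall t, g (upd th N t) <= c) ->
    mean ComplexF (fun t => g (upd th N t)) <= c).
  { intros th c Hc. rewrite <- (mean_const ComplexF c).
    apply mean_le; auto using nice1_const. }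
  exists L, M; split; [easy|split].
  - intros th. apply Rabs_le; split.
    + rewrite <- (mean_const ComplexF (- M)). apply mean_le; auto.
      apply (nice1_const ComplexF). intros t _.
      specialize (HM (upd th N t)); apply Rabs_le_between in HM; lra.
    + apply HA; intros t. specialize (HM (upd th N t)); apply Rabs_le_between in HM; lra.
  - assert (HD : forall th th', mean ComplexF (fun t => g (upd th N t)) <=
       L * rsum N (fun j => Rabs (th j - th' j)) + mean ComplexF (fun t => g (upd th' N t))).
    { intros th th'. set (d := L * _).
      replace (d + mean ComplexF (fun t => g (upd th' N t)))
        with (mean ComplexF (fun t => d + g (upd th' N t))).
      - apply mean_le; auto. { apply (nice1_plus ComplexF); [apply (nice1_const ComplexF)|auto]. }
        intros t _. specialize (H (upd th N t) (upd th' N t)).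
        simpl in H. rewrite !upd_eq, Rminus_diag, Rabs_R0, Rplus_0_r in H.
        rewrite (rsum_ext N _ (fun j => Rabs (th j - th' j))) in H.
        + fold d in H. apply Rabs_le_between in H; lra.
        + intros j Hj; rewrite !upd_neq by lia; easy.
      - rewrite mean_plus, mean_const; auto using nice1_const. }
    intros th th'. pose proof (HD th th'). pose proof (HD th' th).
    rewrite (rsum_ext N (fun j => Rabs (th' j - th j)) (fun j => Rabs (th j - th' j))) in H1
      by (intros; apply Rabs_minus_sym).
    apply Rabs_le; lra.
Qed.

(** * Averaging over all random parameters *)

Lemma avg_le K N f g : nice K N f -> nice K N g ->
  (forall th, (forall j, valid K (th j)) -> f th <= g th) -> avg K N f <= avg K N g.
Proof.
  revert f g; induction N as [|N IH]; intros f g Hf Hg H; simpl.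
  - apply H; intros; destruct K; simpl; auto.
  - apply IH; auto using nice_mean. intros th Hth.
    apply mean_le; auto using nice_slice. intros t Ht; apply H; intros j.
    unfold upd; destruct (Nat.eqb j N); easy.
Qed.

Lemma avg_ext K N f g :
  (forall th, (forall j, valid K (th j)) -> f th = g th) -> avg K N f = avg K N g.
Proof.
  revert f g; induction N as [|N IH]; intros f g H; simpl.
  - apply H; intros; destruct K; simpl; auto.
  - apply IH. intros th Hth.
    apply mean_ext; intros t Ht; apply H; intros j.
    unfold upd; destruct (Nat.eqb j N); easy.
Qed.

Lemma avg_plus K N f g : nice K N f -> nice K N g ->
  avg K N (fun th => f th + g th) = avg K N f + avg K N g.
Proof.
  revert f g; induction N as [|N IH]; intros f g Hf Hg; simpl; [easy|].
  rewrite <- IH; auto using nice_mean.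
  apply avg_ext; intros; apply mean_plus; auto using nice_slice.
Qed.

Lemma avg_scal K N c f : nice K N f -> avg K N (fun th => c * f th) = c * avg K N f.
Proof.
  revert f; induction N as [|N IH]; intros f Hf; simpl; [easy|].
  rewrite <- IH; auto using nice_mean.
  apply avg_ext; intros; apply mean_scal; auto using nice_slice.
Qed.

Lemma avg_const K N c : avg K N (fun _ => c) = c.
Proof.
  induction N as [|N IH]; simpl; [easy|]. etransitivity; [|apply IH].
  apply avg_ext; intros; apply mean_const.
Qed.

Lemma avg_rsum K N n (f : nat -> (nat -> R) -> R) : (forall v, nice K N (f v)) ->
  avg K N (fun th => rsum n (fun v => f v th)) = rsum n (fun v => avg K N (f v)).
Proof.
  intros H; induction n as [|n IH]; simpl; [apply avg_const|].
  rewrite avg_plus, IH; auto. apply nice_rsum; easy.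
Qed.

(** * Khinchine's inequality *)

Definition nsq (z : C) : R := fst z ^ 2 + snd z ^ 2.

Lemma nsq_nonneg z : 0 <= nsq z.
Proof. unfold nsq; nra. Qed.

Lemma Cmod_sqr z : Cmod z ^ 2 = nsq z.
Proof. unfold Cmod; apply pow2_sqrt, nsq_nonneg. Qed.

Lemma Cmod_nonneg z : 0 <= Cmod z.
Proof. apply sqrt_pos. Qed.

Lemma fst_csum n f : fst (csum n f) = rsum n (fun j => fst (f j)).
Proof. induction n as [|n IH]; simpl; [easy|rewrite IH; easy]. Qed.

Lemma csum_ext n f g : (forall j, (j < n)%nat -> f j = g j) -> csum n f = csum n g.
Proof.
  intros H; induction n as [|n IH]; simpl; [easy|]. rewrite IH, H; auto.
Qed.

Definition rand_sum (K : field) (a : nat -> C) (N : nat) (th : nat -> R) : C :=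
  csum N (fun j => Cmul (a j) (phase K (th j))).

Lemma nice_rand_sum_fst K a n N : (n <= N)%nat -> nice K N (fun th => fst (rand_sum K a n th)).
Proof.
  unfold rand_sum; induction n as [|n IH]; intros Hn; simpl; [apply nice_const|].
  apply nice_plus; [apply IH; lia|].
  apply (nice_plus K N (fun th => fst (a n) * fst (phase K (th n)))
    (fun th => - (snd (a n) * snd (phase K (th n))))).
  - apply nice_scal, nice_coord; auto.
  - replace (fun th => - (snd (a n) * snd (phase K (th n))))
      with (fun th => (- snd (a n)) * snd (phase K (th n)))
      by (apply functional_extensionality; intros; ring).
    apply nice_scal, nice_coord; auto.
Qed.

Lemma nice_rand_sum_snd K a n N : (n <= N)%nat -> nice K N (fun th => snd (rand_sum K a n th)).
Proof.
  unfold rand_sum; induction n as [|n IH]; intros Hn; simpl; [apply nice_const|].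
  apply nice_plus; [apply IH; lia|].
  apply nice_plus; apply nice_scal, nice_coord; auto.
Qed.

Lemma nice_nsq_rand_sum K a n N : (n <= N)%nat -> nice K N (fun th => nsq (rand_sum K a n th)).
Proof.
  intros H. apply (nice_plus K N (fun th => fst (rand_sum K a n th) ^ 2)
    (fun th => snd (rand_sum K a n th) ^ 2)); simpl.
  - apply nice_mult; [|apply nice_mult]; auto using nice_rand_sum_fst, nice_const.
  - apply nice_mult; [|apply nice_mult]; auto using nice_rand_sum_snd, nice_const.
Qed.

(** Multiplying by [x^(2-p)] reduces the powers to squares: [y^p x^(2-p) >= y^2], so the left side
    becomes at most [x^2 - y^2 <= 2x(x - y)], and [x = x^(p-1) x^(2-p)]. *)
Lemma rpow_lipschitz p D x y : 1 <= p <= 2 -> 0 <= y <= x -> x <= D ->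
  rpow x p - rpow y p <= 2 * rpow D (p - 1) * (x - y).
Proof.
  intros Hp Hy HD.
  assert (HR : 0 <= rpow D (p - 1)) by apply rpow_nonneg.
  destruct (Rle_dec x 0) as [Hx|Hx].
  { replace x with 0 by lra; replace y with 0 by lra. rewrite rpow_0; lra. }
  assert (H1 : rpow x p * rpow x (2 - p) = x * x).
  { rewrite <- rpow_plus; replace (p + (2 - p)) with 2 by ring. rewrite rpow_2; [ring|lra]. }
  assert (H2 : y * y <= rpow y p * rpow x (2 - p)).
  { replace (y * y) with (rpow y p * rpow y (2 - p)).
    - apply Rmult_le_compat_l; [apply rpow_nonneg|]. apply rpow_le; lra.
    - rewrite <- rpow_plus; replace (p + (2 - p)) with 2 by ring. rewrite rpow_2; [ring|lra]. }
  assert (H3 : rpow x (p - 1) * rpow x (2 - p) = x).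
  { rewrite <- rpow_plus; replace (p - 1 + (2 - p)) with 1 by ring. apply rpow_1; lra. }
  assert (H4 : rpow x (p - 1) <= rpow D (p - 1)) by (apply rpow_le; lra).
  assert (H5 : 0 < rpow x (2 - p)) by (apply rpow_pos; lra).
  apply Rle_trans with (2 * rpow x (p - 1) * (x - y)).
  - apply Rmult_le_reg_r with (rpow x (2 - p)); [easy|].
    replace (2 * rpow x (p - 1) * (x - y) * rpow x (2 - p))
      with (2 * (rpow x (p - 1) * rpow x (2 - p)) * (x - y)) by ring.
    rewrite H3. nra.
  - apply Rmult_le_compat_r; lra.
Qed.

Lemma Cmod_le_add z w :
  Cmod z <= Cmod w + (Rabs (fst z - fst w) + Rabs (snd z - snd w)).
Proof.
  pose proof (Cmod_nonneg w) as Hw.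
  pose proof (Rabs_pos (fst z - fst w)). pose proof (Rabs_pos (snd z - snd w)).
  apply Rsqr_incr_0_var; [|lra]. rewrite !Rsqr_pow2, Cmod_sqr.
  pose proof (Cmod_sqr w) as Hs.
  assert (Hf : Rabs (fst w) <= Cmod w).
  { apply Rsqr_incr_0_var; [|easy]. rewrite <- Rsqr_abs, !Rsqr_pow2, Hs. unfold nsq; nra. }
  assert (Hg : Rabs (snd w) <= Cmod w).
  { apply Rsqr_incr_0_var; [|easy]. rewrite <- Rsqr_abs, !Rsqr_pow2, Hs. unfold nsq; nra. }
  pose proof (Rmult_le_compat_r _ _ _ H Hf) as H1.
  pose proof (Rmult_le_compat_r _ _ _ H0 Hg) as H2.
  rewrite <- Rabs_mult in H1, H2.
  pose proof (Rle_abs (fst w * (fst z - fst w))).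
  pose proof (Rle_abs (snd w * (snd z - snd w))).
  pose proof (pow2_abs (fst z - fst w)). pose proof (pow2_abs (snd z - snd w)).
  set (d1 := Rabs (fst z - fst w)) in *. set (d2 := Rabs (snd z - snd w)) in *.
  unfold nsq in *. nra.
Qed.

Lemma nice_rpow_rand_sum K a N p : 1 <= p <= 2 ->
  nice K N (fun th => rpow (Cmod (rand_sum K a N th)) p).
Proof.
  intros Hp. destruct K; [easy|].
  apply (nice_compose2 N (fun th => fst (rand_sum ComplexF a N th))
    (fun th => snd (rand_sum ComplexF a N th)) (fun u w => rpow (Cmod (u, w)) p)).
  2: apply nice_rand_sum_fst; lia.
  2: apply nice_rand_sum_snd; lia.
  (* On the square of half-side [M] the modulus is at most [|u| + |w| <= 2M]. *)
  intros M. exists (2 * rpow (2 * M) (p - 1)), (rpow (2 * M) p). split.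
  { pose proof (rpow_nonneg (2 * M) (p - 1)); lra. }
  assert (HB : forall u w, Rabs u <= M -> Rabs w <= M -> Cmod (u, w) <= 2 * M).
  { intros u w Hu Hw. pose proof (Cmod_le_add (u, w) (0, 0)) as H. simpl in H.
    rewrite !Rminus_0_r in H. replace (Cmod (0, 0)) with 0 in H; [lra|].
    transitivity (sqrt 0); [rewrite sqrt_0; easy|unfold Cmod; f_equal; simpl; ring]. }
  intros u w u' w' Hu Hw Hu' Hw'. split.
  - rewrite Rabs_pos_eq by apply rpow_nonneg.
    apply rpow_le; [lra|]. split; [apply Cmod_nonneg|auto].
  - assert (HL : forall u w u' w', Cmod (u, w) <= 2 * M -> Cmod (u', w') <= Cmod (u, w) ->
      Rabs (rpow (Cmod (u, w)) p - rpow (Cmod (u', w')) p) <=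
      2 * rpow (2 * M) (p - 1) * (Rabs (u - u') + Rabs (w - w'))).
    { clear - Hp. intros u w u' w' HD H. rewrite Rabs_pos_eq.
      - eapply Rle_trans; [apply rpow_lipschitz; [easy|split; [apply Cmod_nonneg|easy]|exact HD]|].
        apply Rmult_le_compat_l; [pose proof (rpow_nonneg (2 * M) (p - 1)); lra|].
        pose proof (Cmod_le_add (u, w) (u', w')) as H'; simpl in H'; lra.
      - assert (rpow (Cmod (u', w')) p <= rpow (Cmod (u, w)) p); [|lra].
        apply rpow_le; [lra|]. split; [apply Cmod_nonneg|easy]. }
    destruct (Rle_dec (Cmod (u', w')) (Cmod (u, w))).
    + apply HL; auto.
    + rewrite Rabs_minus_sym, (Rabs_minus_sym u), (Rabs_minus_sym w). apply HL; auto; lra.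
Qed.

(** * Second and fourth moments of random sums *)

Lemma rand_sum_upd K a N th t :
  rand_sum K a (S N) (upd th N t) = Cadd (rand_sum K a N th) (Cmul (a N) (phase K t)).
Proof.
  unfold rand_sum; simpl. rewrite upd_eq. f_equal.
  apply csum_ext; intros; rewrite upd_neq by lia; easy.
Qed.

(** Twice the real part of [conj(z) a e], arranged as a linear form in the coordinates of [e] so
    that its mean over [e] vanishes. *)
Definition cross (z a e : C) : R :=
  2 * (fst z * fst a + snd z * snd a) * fst e + 2 * (snd z * fst a - fst z * snd a) * snd e.

Lemma nsq_add z a e : nsq e = 1 -> nsq (Cadd z (Cmul a e)) = nsq z + nsq a + cross z a e.
Proof.
  intros H. replace (nsq a) with (nsq a * nsq e) by (rewrite H; ring).
  unfold nsq, cross; simpl; ring.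
Qed.

Lemma cross_sqr z a e : nsq e = 1 -> cross z a e ^ 2 <= 4 * nsq z * nsq a.
Proof.
  intros H. replace (4 * nsq z * nsq a) with (4 * nsq z * nsq a * nsq e) by (rewrite H; ring).
  unfold nsq, cross. apply Rminus_le_0.
  (* The difference is the square of twice the imaginary part of [conj(z) a e]. *)
  match goal with |- 0 <= ?t => replace t with
    ((2 * (fst z * fst a + snd z * snd a) * snd e - 2 * (snd z * fst a - fst z * snd a) * fst e) ^ 2)
    by ring end.
  apply pow2_ge_0.
Qed.

Lemma second_moment K a N :
  avg K N (fun th => nsq (rand_sum K a N th)) = rsum N (fun j => nsq (a j)).
Proof.
  induction N as [|N IH]; simpl; [unfold nsq; simpl; ring|].
  rewrite <- IH. rewrite <- (avg_const K N (nsq (a N))).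
  rewrite <- avg_plus by auto using nice_nsq_rand_sum, nice_const.
  apply avg_ext; intros th _.
  rewrite <- (mean_affine K (nsq (rand_sum K a N th) + nsq (a N))
    (2 * (fst (rand_sum K a N th) * fst (a N) + snd (rand_sum K a N th) * snd (a N)))
    (2 * (snd (rand_sum K a N th) * fst (a N) - fst (rand_sum K a N th) * snd (a N)))).
  apply mean_ext; intros t Ht. rewrite rand_sum_upd. apply nsq_add, valid_phase; easy.
Qed.

(** With [b = |z|^2 + c], adding one term gives [(b + cross)^2]. Its linear part averages to [0] and
    [cross^2 <= 4 |z|^2 c], so the new moment is at most [3 s^2 + 6 c s + c^2 <= 3 (s + c)^2]. *)
Lemma fourth_moment K a N :
  avg K N (fun th => nsq (rand_sum K a N th) ^ 2) <= 3 * rsum N (fun j => nsq (a j)) ^ 2.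
Proof.
  assert (Hn : forall n N, (n <= N)%nat -> nice K N (fun th => nsq (rand_sum K a n th) ^ 2)).
  { intros; simpl; repeat apply nice_mult; auto using nice_nsq_rand_sum, nice_const. }
  induction N as [|N IH]; simpl avg; [unfold nsq; simpl; lra|].
  set (c := nsq (a N)).
  apply Rle_trans with (avg K N (fun th => nsq (rand_sum K a N th) ^ 2 +
    (6 * c * nsq (rand_sum K a N th) + c ^ 2))).
  - apply avg_le.
    + apply (nice_mean K N (fun th => nsq (rand_sum K a (S N) th) ^ 2)); auto.
    + repeat apply nice_plus; auto using nice_const, nice_scal, nice_nsq_rand_sum.
    + intros th _. set (z := rand_sum K a N th). set (b := nsq z + c).
      replace (nsq z ^ 2 + (6 * c * nsq z + c ^ 2)) with
        (mean K (fun t => (b ^ 2 + 4 * nsq z * c) +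
          (2 * b * (2 * (fst z * fst (a N) + snd z * snd (a N))) * fst (phase K t) +
           2 * b * (2 * (snd z * fst (a N) - fst z * snd (a N))) * snd (phase K t))))
        by (rewrite mean_affine; unfold b; ring).
      apply mean_le.
      * apply (nice_slice K N (fun th => nsq (rand_sum K a (S N) th) ^ 2)); auto.
      * repeat apply nice1_plus; auto using nice1_const, nice1_scal, nice1_phase.
      * intros t Ht. destruct (valid_phase K t Ht) as [_ He].
        rewrite rand_sum_upd. fold z. rewrite nsq_add by exact He. fold c b.
        pose proof (cross_sqr z (a N) _ He) as Hc. fold c in Hc.
        match goal with |- _ <= ?r => replace r with
          (b ^ 2 + 4 * nsq z * c + 2 * b * cross z (a N) (phase K t)) by (unfold cross; ring) end.
        replace ((b + cross z (a N) (phase K t)) ^ 2) with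
          (b ^ 2 + cross z (a N) (phase K t) ^ 2 + 2 * b * cross z (a N) (phase K t)) by ring.
        lra.
  - rewrite !avg_plus, avg_scal, avg_const, second_moment;
      auto using nice_plus, nice_scal, nice_const, nice_nsq_rand_sum.
    simpl rsum. fold c. set (s := rsum N (fun j => nsq (a j))) in *.
    assert (0 <= c) by apply nsq_nonneg. nra.
Qed.

(* [x^p k^(2-p) >= x^2 - x^4/k^2] for all [x >= 0]; with [k] twice the [L2] norm the second and
   fourth moments bound the [p]-th moment from below. *)
Lemma Khin_admissible_eighth K p : 1 <= p <= 2 -> Khin_admissible K p (/ 8).
Proof.
  intros Hp N a _. rewrite Expect_avg.
  change (fun th : nat -> R => rpow (Cmod (csum N (fun j => Cmul (a j) (phase K (th j))))) p)
    with (fun th => rpow (Cmod (rand_sum K a N th)) p).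
  rewrite (rsum_ext N _ (fun j => nsq (a j))) by (intros; apply Cmod_sqr).
  set (s := rsum N (fun j => nsq (a j))).
  assert (Hs : 0 <= s) by (apply rsum_nonneg; intros; apply nsq_nonneg).
  set (E := avg K N _).
  destruct Hs as [Hs|Hs].
  2: { rewrite <- Hs, sqrt_0, Rmult_0_r; apply rpow_nonneg. }
  assert (Hq : 0 < sqrt s) by (apply sqrt_lt_R0; easy).
  assert (Hqs : sqrt s ^ 2 = s) by (apply pow2_sqrt; lra).
  set (k := 2 * sqrt s).
  assert (Hk : 0 < k) by (unfold k; lra).
  assert (Hkp : 0 < rpow k (2 - p)) by (apply rpow_pos; easy).
  (* The moments [s] and at most [3 s^2], with [k^2 = 4 s], leave [s - 3 s^2 / k^2 = s / 4]. *)
  assert (HE : s / 4 <= rpow k (2 - p) * E).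
  { unfold E. rewrite <- avg_scal by (apply nice_rpow_rand_sum; easy).
    apply Rle_trans with (avg K N (fun th => nsq (rand_sum K a N th) +
      (- / k ^ 2) * nsq (rand_sum K a N th) ^ 2)).
    - assert (Hn2 : nice K N (fun th => nsq (rand_sum K a N th) ^ 2)).
      { simpl; repeat apply nice_mult; auto using nice_nsq_rand_sum, nice_const. }
      rewrite avg_plus, avg_scal, second_moment; auto using nice_nsq_rand_sum, nice_scal.
      pose proof (fourth_moment K a N) as H4. fold s in H4 |- *.
      assert (Hk2 : 0 < / k ^ 2) by (apply Rinv_0_lt_compat, pow_lt; easy).
      apply Rle_trans with (s - / k ^ 2 * (3 * s ^ 2)); [|nra].
      right. replace (k ^ 2) with (4 * s) by (unfold k; rewrite Rpow_mult_distr, Hqs; ring).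
      field; lra.
    - apply avg_le.
      + apply nice_plus; [|apply nice_scal; simpl; repeat apply nice_mult];
          auto using nice_nsq_rand_sum, nice_const.
      + apply nice_scal, nice_rpow_rand_sum; easy.
      + intros th _. set (z := rand_sum K a N th). rewrite <- Cmod_sqr.
        pose proof (Cmod_nonneg z) as Hx. set (x := Cmod z) in *.
        pose proof (rpow_nonneg x p) as Hxp.
        assert (Hk2 : 0 < / k ^ 2) by (apply Rinv_0_lt_compat, pow_lt; easy).
        destruct (Rle_dec x k) as [Hxk|Hxk].
        * apply Rle_trans with (x ^ 2).
          { assert (0 <= / k ^ 2 * (x ^ 2) ^ 2); [|lra].
            apply Rmult_le_pos; [lra|apply pow2_ge_0]. }
          rewrite <- rpow_2 by easy. replace 2 with ((2 - p) + p) at 1 by ring.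
          rewrite rpow_plus. apply Rmult_le_compat_r; [easy|]. apply rpow_le; lra.
        * apply Rle_trans with 0; [|apply Rmult_le_pos; lra].
          replace (x ^ 2 + - / k ^ 2 * (x ^ 2) ^ 2) with (/ k ^ 2 * (x ^ 2) * (k ^ 2 - x ^ 2))
            by (field; lra).
          assert (0 <= / k ^ 2 * x ^ 2) by (apply Rmult_le_pos; [lra|apply pow2_ge_0]).
          assert (k ^ 2 - x ^ 2 <= 0) by nra. nra. }
  rewrite <- (rpow_inv_r (/ 8 * sqrt s) p) by lra.
  apply rpow_le; [left; apply Rinv_0_lt_compat; lra|].
  split; [apply rpow_nonneg|].
  apply Rmult_le_reg_l with (rpow k (2 - p)); [easy|].
  eapply Rle_trans; [|exact HE].
  (* Since [sqrt s / 8 = k / 16], the left side is [k^2 16^(-p) <= 4 s / 16]; this is where the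
     value [1/8] comes from. *)
  replace (/ 8 * sqrt s) with (k * / 16) by (unfold k; field).
  rewrite rpow_mult_distr by lra. rewrite <- Rmult_assoc, <- rpow_plus.
  replace (2 - p + p) with 2 by ring. rewrite rpow_2 by lra.
  pose proof (rpow_le_base_le_1 (/ 16) p) as H16.
  assert (Hks : k ^ 2 = 4 * s) by (unfold k; rewrite Rpow_mult_distr, Hqs; ring).
  rewrite Hks. apply Rle_trans with (4 * s * / 16); [|lra].
  apply Rmult_le_compat_l; [lra|apply H16; lra].
Qed.

(** Tested on the single coefficient [1], whose random sum has modulus [1]. Besides bounding the
    admissible constants, it makes the final product at least [1], as [BH_admissible] demands. *)
Lemma Khin_admissible_le_1 K p A : 1 <= p <= 2 -> Khin_admissible K p A -> A <= 1.
Proof.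
  intros Hp H.
  specialize (H 1%nat (fun _ => C1)). rewrite Expect_avg in H.
  change (fun th : nat -> R => rpow (Cmod (csum 1 (fun j => Cmul C1 (phase K (th j))))) p)
    with (fun th => rpow (Cmod (rand_sum K (fun _ => C1) 1 th)) p) in H.
  replace (rsum 1 (fun _ => Cmod C1 ^ 2)) with 1 in H.
  2: { change (1 = 0 + Cmod C1 ^ 2); rewrite Cmod_sqr; unfold nsq; simpl; ring. }
  rewrite sqrt_1, Rmult_1_r in H.
  eapply Rle_trans; [apply H; intros; destruct K; easy|].
  rewrite (avg_ext K 1 _ (fun _ => 1)).
  - rewrite avg_const, rpow_one_l; lra.
  - intros th Hth. destruct (valid_phase K (th O) (Hth O)) as [_ He].
    replace (Cmod _) with 1; [apply rpow_one_l|].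
    transitivity (sqrt 1); [rewrite sqrt_1; easy|unfold Cmod; f_equal; simpl in *; lra].
Qed.

(** The supremum of the admissible constants is itself admissible, because each condition has the
    form [A s <= rhs] with [s >= 0]; it is positive because [1/8] is admissible. *)
Lemma Khin_const_exists K p : 1 <= p <= 2 ->
  exists A, is_Khin_const K p A /\ 0 < A <= 1.
Proof.
  intros Hp. destruct (completeness (Khin_admissible K p)) as (A & HU & HL).
  - exists 1; intros A HA; apply (Khin_admissible_le_1 K p); easy.
  - exists (/ 8); apply Khin_admissible_eighth; easy.
  - assert (HA : / 8 <= A) by (apply HU, Khin_admissible_eighth; easy).
    exists A; repeat split.
    + intros N a Ha. set (rhs := rpow _ _). set (s := sqrt _).
      assert (Hs : 0 <= s) by apply sqrt_pos.
      destruct Hs as [Hs|Hs].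
      2: { rewrite <- Hs, Rmult_0_r; apply rpow_nonneg. }
      apply Rmult_le_reg_r with (/ s); [apply Rinv_0_lt_compat; easy|].
      rewrite Rmult_assoc, Rinv_r, Rmult_1_r by lra.
      apply HL; intros A' HA'. specialize (HA' N a Ha). fold s rhs in HA'.
      apply Rmult_le_reg_r with s; [easy|]. rewrite Rmult_assoc, Rinv_l; lra.
    + intros A' HA'; apply HU; easy.
    + lra.
    + apply HL; intros A' HA'; apply (Khin_admissible_le_1 K p); easy.
Qed.

(** * Multilinear forms *)

Lemma nice_msum K N n l (f : tuple -> (nat -> R) -> R) x : (forall y, nice K N (f y)) ->
  nice K N (fun th => msum n l (fun y => f y th) x).
Proof.
  intros H; revert x; induction l as [|k l IH]; intros x; simpl; [apply H|].
  apply (nice_rsum K N n (fun v th => msum n l (fun y => f y th) (upd x k (unitv v)))); auto.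
Qed.

Lemma msum_avg K N n l (f : tuple -> (nat -> R) -> R) x : (forall y, nice K N (f y)) ->
  msum n l (fun y => avg K N (f y)) x = avg K N (fun th => msum n l (fun y => f y th) x).
Proof.
  intros H; revert x; induction l as [|k l IH]; intros x; simpl; [easy|].
  rewrite (avg_rsum K N n (fun v th => msum n l (fun y => f y th) (upd x k (unitv v))))
    by (intros; apply nice_msum; easy).
  apply rsum_ext; auto.
Qed.

Lemma inK_unitv K v j : inK K (unitv v j).
Proof. unfold unitv; destruct (Nat.eqb j v), K; easy. Qed.

Lemma inK_upd K (x : tuple) k z :
  (forall i j, inK K (x i j)) -> (forall j, inK K (z j)) ->
  forall i j, inK K (upd x k z i j).
Proof. intros Hx Hz i j; unfold upd; destruct (Nat.eqb i k); auto. Qed.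

Definition in_ball (K : field) (m n : nat) (x : tuple) : Prop :=
  (forall k j, inK K (x k j)) /\
  (forall k j, (k < m)%nat -> (j < n)%nat -> Cmod (x k j) <= 1).

Lemma in_ball_upd K m n x k z : in_ball K m n x ->
  (forall j, inK K (z j)) -> (forall j, Cmod (z j) <= 1) -> in_ball K m n (upd x k z).
Proof.
  intros [Hx Hx1] Hz Hz1; split; [apply inK_upd; easy|].
  intros i j Hi Hj; unfold upd; destruct (Nat.eqb i k); auto.
Qed.

Lemma Cmod_C0 : Cmod C0 = 0.
Proof. transitivity (sqrt 0); [unfold Cmod; f_equal; simpl; ring|apply sqrt_0]. Qed.

Lemma Cmod_C1 : Cmod C1 = 1.
Proof. transitivity (sqrt 1); [unfold Cmod; f_equal; simpl; ring|apply sqrt_1]. Qed.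

Lemma Cmod_le_1 z : nsq z <= 1 -> Cmod z <= 1.
Proof. intros H; rewrite <- sqrt_1; apply sqrt_le_1_alt; easy. Qed.

Lemma in_ball_unitv K m n (J : nat -> nat) : in_ball K m n (fun k => unitv (J k)).
Proof.
  split; intros; [apply inK_unitv|].
  unfold unitv; destruct (Nat.eqb _ _); rewrite ?Cmod_C0, ?Cmod_C1; lra.
Qed.

Section Multilinear.
Context {K : field} {m n : nat} {T : tuple -> C} {N : R}.
Hypothesis T_lin : is_mlinear K m n T.
Hypothesis T_bound : forall x, in_ball K m n x -> Cmod (T x) <= N.

Lemma bound_nonneg : 0 <= N.
Proof.
  eapply Rle_trans; [apply Cmod_nonneg|].
  apply (T_bound (fun k => unitv k)), (in_ball_unitv K m n (fun k => k)).
Qed.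

(** Linearity adds one multiple of a unit vector at a time, so the induction runs over truncations
    of [z]; the one at [n] agrees with [z] on all coordinates that [T] sees. *)
Lemma mlinear_expand x k z : (k < m)%nat ->
  (forall i j, inK K (x i j)) -> (forall j, inK K (z j)) ->
  T (upd x k z) = csum n (fun v => Cmul (T (upd x k (unitv v))) (z v)).
Proof.
  intros Hk Hx Hz. destruct T_lin as (Text & Tadd & _).
  set (zr := fun r j => if Nat.ltb j r then z j else C0).
  assert (Hzr : forall r j, inK K (zr r j)).
  { intros r j; unfold zr; destruct (Nat.ltb j r); auto. destruct K; easy. }
  assert (Hr : forall r, T (upd x k (zr r)) =
     csum r (fun v => Cmul (T (upd x k (unitv v))) (z v))).
  { induction r as [|r IH].
    (* The zero vector is [0 + 1 0], so the value of [T] there equals its own double and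
       vanishes. *)
    - specialize (Tadd (upd x k (zr O)) k C1 (zr O)).
      rewrite !upd_twice, upd_eq in Tadd.
      replace (fun j => Cadd (zr O j) (Cmul C1 (zr O j))) with (zr O) in Tadd.
      2: { apply functional_extensionality; intros j; unfold zr; simpl.
           unfold Cadd, Cmul, C0; simpl; f_equal; ring. }
      assert (E : T (upd x k (zr O)) = Cadd (T (upd x k (zr O))) (Cmul C1 (T (upd x k (zr O))))).
      { apply Tadd; auto using inK_upd. destruct K; easy. }
      simpl csum. destruct (T (upd x k (zr O))) as [a b].
      unfold Cadd, Cmul, C0 in *; simpl in *. injection E; intros. f_equal; lra.
    - simpl csum. rewrite <- IH.
      specialize (Tadd (upd x k (zr r)) k (z r) (unitv r)).
      rewrite !upd_twice, upd_eq in Tadd.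
      replace (zr (S r)) with (fun j => Cadd (zr r j) (Cmul (z r) (unitv r j))).
      + rewrite Tadd; auto using inK_upd, inK_unitv.
        f_equal. unfold Cmul; f_equal; ring.
      + apply functional_extensionality; intros j; unfold zr, unitv.
        destruct (Nat.ltb_spec j r), (Nat.ltb_spec j (S r)), (Nat.eqb_spec j r); try lia;
          subst; unfold Cadd, Cmul, C0, C1; simpl;
          [destruct (z j)|destruct (z r)|]; simpl; f_equal; ring. }
  rewrite <- Hr. apply Text; intros i j Hi Hj. unfold upd, zr.
  destruct (Nat.eqb i k); [|easy]. apply Nat.ltb_lt in Hj; rewrite Hj; easy.
Qed.

(** Duality of [l_1] and [l_infty] in one slot: a vector of conjugate signs makes all terms add up
    without cancellation. It is the base of the induction. *)
Lemma sum_Cmod_le x k : (k < m)%nat -> in_ball K m n x ->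
  rsum n (fun v => Cmod (T (upd x k (unitv v)))) <= N.
Proof.
  intros Hk Hx. set (t := fun v => T (upd x k (unitv v))).
  assert (Ht : forall v, inK K (t v)).
  { intros v; apply T_lin, inK_upd; [apply Hx|apply inK_unitv]. }
  (* conjugate sign of [t v]; it is [0] when [t v = 0] since [/ 0 = 0] *)
  set (z := fun v => (fst (t v) * / Cmod (t v), - snd (t v) * / Cmod (t v)) : C).
  assert (Hz : forall v, inK K (z v)).
  { intros v; specialize (Ht v); destruct K; simpl in *; [rewrite Ht; ring|easy]. }
  assert (Hz1 : forall v, Cmod (z v) <= 1 /\ fst (Cmul (t v) (z v)) = Cmod (t v)).
  { intros v; unfold z; simpl. pose proof (Cmod_sqr (t v)) as Hs. unfold nsq in Hs.
    destruct (Cmod_nonneg (t v)) as [H0|H0].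
    - split.
      + apply Cmod_le_1; unfold nsq; simpl fst; simpl snd.
        replace (_ + _) with ((fst (t v) ^ 2 + snd (t v) ^ 2) * (/ Cmod (t v)) ^ 2) by ring.
        rewrite <- Hs; right; field; lra.
      + replace (_ - _) with ((fst (t v) ^ 2 + snd (t v) ^ 2) * / Cmod (t v)) by ring.
        rewrite <- Hs; field; lra.
    - rewrite <- H0, Rinv_0, !Rmult_0_r. split; [|ring].
      change (Cmod C0 <= 1); rewrite Cmod_C0; lra. }
  assert (HT : Cmod (T (upd x k z)) <= N).
  { apply T_bound, in_ball_upd; auto. apply Hz1. }
  rewrite mlinear_expand in HT; auto; [|apply Hx].
  eapply Rle_trans; [|exact HT].
  rewrite (rsum_ext n _ (fun v => fst (Cmul (t v) (z v)))) by (intros; symmetry; apply Hz1).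
  rewrite <- fst_csum. fold t. set (S := csum n _).
  eapply Rle_trans; [apply Rle_abs|]. rewrite <- sqrt_Rsqr_abs.
  apply sqrt_le_1_alt. rewrite Rsqr_pow2. pose proof (pow2_ge_0 (snd S)).
  lra.
Qed.

(** Khinchine replaces each square function by an average over signs, which is then taken outside
    the sum. For fixed signs the random sum is [T] with the sign vector in position [i], a point of
    the ball, where the bound [D] applies. *)
Lemma msum_square_function_le A p i l D x :
  Khin_admissible K p A -> 0 < A -> 1 <= p <= 2 -> (i < m)%nat -> ~ In i l ->
  in_ball K m n x ->
  (forall y, in_ball K m n y -> msum n l (fun y => rpow (Cmod (T y)) p) y <= D) ->
  msum n l (fun y =>
    rpow (rpow (rsum n (fun v => rpow (Cmod (T (upd y i (unitv v)))) 2)) (/ 2)) p) x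
  <= rpow (/ A) p * D.
Proof.
  intros HA HA0 Hp Hi Hil Hx HD.
  set (f := fun y th => rpow (Cmod (rand_sum K (fun v => T (upd y i (unitv v))) n th)) p).
  assert (Hf : forall y, nice K n (f y)) by (intros; apply nice_rpow_rand_sum; easy).
  set (P := fun y : tuple => forall k j, inK K (y k j)).
  assert (HP : forall y k v, P y -> P (upd y k (unitv v))).
  { intros y k v Hy; exact (inK_upd K y k (unitv v) Hy (inK_unitv K v)). }
  apply Rle_trans with (msum n l (fun y => rpow (/ A) p * avg K n (f y)) x).
  - apply (msum_le n l P); [easy| |exact (proj1 Hx)]. intros y Hy.
    rewrite rpow_half by (apply rsum_nonneg; intros; apply rpow_nonneg).
    assert (HK := HA n (fun v => T (upd y i (unitv v)))
       (fun v => proj2 (proj2 T_lin) _ (HP y i v Hy))).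
    rewrite Expect_avg in HK.
    rewrite (rsum_ext n _ (fun v => Cmod (T (upd y i (unitv v))) ^ 2))
      by (intros; apply rpow_2, Cmod_nonneg).
    change (fun th : nat -> R => rpow (Cmod (csum n (fun v =>
      Cmul (T (upd y i (unitv v))) (phase K (th v))))) p) with (f y) in HK.
    assert (HE : 0 <= avg K n (f y)).
    { rewrite <- (avg_const K n 0). apply avg_le; auto using nice_const.
      intros; apply rpow_nonneg. }
    set (sq := sqrt _) in *.
    assert (Hsq : sq <= / A * rpow (avg K n (f y)) (/ p)).
    { apply Rmult_le_reg_l with A; [easy|]. rewrite <- Rmult_assoc, Rinv_r by lra. lra. }
    eapply Rle_trans; [apply rpow_le; [lra|split; [apply sqrt_pos|exact Hsq]]|].
    rewrite rpow_mult_distr, rpow_inv_l; auto; try lra.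
    + left; apply Rinv_0_lt_compat; easy.
    + apply rpow_nonneg.
  - rewrite msum_scal. apply Rmult_le_compat_l; [apply rpow_nonneg|].
    rewrite msum_avg by easy. rewrite <- (avg_const K n D).
    apply avg_le; auto using nice_const, nice_msum.
    (* From here the signs are fixed, and multilinearity collapses the sum over [v] into one
       evaluation at [e]. *)
    intros th Hth. set (e := fun j => phase K (th j)).
    assert (He : forall j, inK K (e j)) by (intros; apply valid_phase; easy).
    apply Rle_trans with (msum n l (fun y => rpow (Cmod (T (upd y i e))) p) x).
    + apply (msum_le n l P); [easy| |exact (proj1 Hx)]. intros y Hy.
      rewrite mlinear_expand by easy. unfold f, rand_sum, e; lra.
    + rewrite (msum_upd n l i e (fun y => rpow (Cmod (T y)) p)) by easy.
      apply HD, in_ball_upd; auto.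
      intros j; apply Cmod_le_1. right. apply (valid_phase K (th j)); easy.
Qed.

Lemma mixl_endpoint_le A p i l C x :
  Khin_admissible K p A -> 0 < A -> 1 <= p < 2 -> 0 <= C ->
  NoDup l -> In i l -> (forall k, In k l -> (k < m)%nat) -> in_ball K m n x ->
  (forall y, in_ball K m n y ->
     mixl n (fun _ => p) (remove Nat.eq_dec i l) (fun y => Cmod (T y)) y <= C) ->
  mixl n (fun k => if Nat.eq_dec k i then 2 else p) l (fun y => Cmod (T y)) x <= / A * C.
Proof.
  intros HA HA0 Hp HC Hnd Hi Hlm Hx HB.
  set (P := fun k => if Nat.eq_dec k i then 2 else p).
  assert (HPi : P i = 2) by (unfold P; destruct (Nat.eq_dec i i); easy).
  assert (HPk : forall k, k <> i -> P k = p) by (intros k Hk; unfold P; destruct (Nat.eq_dec k i); easy).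
  assert (HPpos : forall k, 0 < P k) by (intros k; unfold P; destruct (Nat.eq_dec k i); lra).
  assert (Him : (i < m)%nat) by auto.
  assert (HH : forall y, 0 <= Cmod (T y)) by (intros; apply Cmod_nonneg).
  destruct (in_split i l Hi) as (l1 & l2 & ->).
  pose proof (NoDup_remove_2 _ _ _ Hnd) as Hni.
  replace (remove Nat.eq_dec i (l1 ++ i :: l2)) with (l1 ++ l2) in HB.
  2: { rewrite remove_app. simpl. destruct (Nat.eq_dec i i); [|easy].
       rewrite !notin_remove; auto using in_or_app. }
  assert (Hne : forall k, In k (l1 ++ l2) -> k <> i) by (intros k Hk ->; easy).
  rewrite mixl_app.
  apply Rle_trans with (mixl n P l1 (mixl n P (l2 ++ [i]) (fun y => Cmod (T y))) x).
  { apply mixl_le; [auto|]. intros y; split; [apply mixl_nonneg; easy|].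
    apply mixl_move_last; auto using in_or_app.
    intros k Hk; rewrite HPi, HPk by auto using in_or_app; lra. }
  rewrite <- mixl_app, app_assoc, mixl_app.
  rewrite (mixl_ext_exp n P (fun _ => p)) by auto.
  rewrite mixl_const; [|lra|intros; apply mixl_nonneg; easy].
  (* With position [i] innermost, the others share the exponent [p]; comparing [p]-th powers leaves
     flat sums of square functions. *)
  rewrite <- (rpow_inv_r (/ A * C) p); [|lra|].
  2: apply Rmult_le_pos; [left; apply Rinv_0_lt_compat|]; easy.
  apply rpow_le; [left; apply Rinv_0_lt_compat; lra|].
  split; [apply msum_nonneg; intros; apply rpow_nonneg|].
  rewrite rpow_mult_distr by (try easy; left; apply Rinv_0_lt_compat; easy).
  simpl mixl. rewrite HPi.
  apply msum_square_function_le; auto; [lra|].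
  intros y Hy. specialize (HB y Hy). rewrite mixl_const in HB; [|lra|easy].
  assert (Hp0 : 0 <= p) by lra.
  pose proof (rpow_le _ _ p Hp0 (conj (rpow_nonneg _ _) HB)) as Hle.
  rewrite rpow_inv_l in Hle; [easy|lra|]. apply msum_nonneg; intros; apply rpow_nonneg.
Qed.

End Multilinear.

(** * The inductive step and the optimal constants *)

Lemma lsum_pos {I} (l : list I) f : l <> [] -> (forall i, In i l -> 0 < f i) -> 0 < lsum l f.
Proof.
  intros Hl Hf. destruct l as [|i l]; [easy|]. simpl.
  assert (lsum l (fun _ => 0) <= lsum l f) by (apply lsum_le; intros; left; auto with datatypes).
  rewrite lsum_const in H. specialize (Hf i (or_introl eq_refl)). lra.
Qed.

Lemma remove_NoDup l i : NoDup l -> NoDup (remove Nat.eq_dec i l).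
Proof.
  induction l as [|j l IH]; simpl; intros H; [easy|]. inversion H; subst.
  destruct (Nat.eq_dec i j); auto. constructor; auto.
  intros Hin; apply in_remove in Hin; easy.
Qed.

Lemma remove_length l i : NoDup l -> In i l -> length l = S (length (remove Nat.eq_dec i l)).
Proof.
  induction l as [|j l IH]; simpl; intros Hnd Hi; [easy|]. inversion Hnd; subst.
  destruct (Nat.eq_dec i j) as [->|Hij]; [rewrite notin_remove; auto|].
  destruct Hi as [->|Hi]; [easy|]. simpl; f_equal; auto.
Qed.

Section Induction.
Context {K : field} {m n : nat} {T : tuple -> C} {N : R}.
Hypothesis T_lin : is_mlinear K m n T.
Hypothesis T_bound : forall x, in_ball K m n x -> Cmod (T x) <= N.
Context {A : nat -> R}.
Hypothesis A_Khin : forall j, (2 <= j)%nat ->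
  is_Khin_const K ((2 * INR j - 2) / INR j) (A j) /\ 0 < A j <= 1.

(** The constant for [s + 1] variables: the factors are the inverses of [A 2] to [A (s + 1)], and
    [bh 0 = 1]. *)
Let bh s := rprod s (fun i => / A (i + 2)%nat).

Lemma bh_nonneg s : 0 <= bh s.
Proof.
  unfold bh; induction s as [|s IH]; simpl; [lra|]. apply Rmult_le_pos; [easy|].
  left; apply Rinv_0_lt_compat, A_Khin; lia.
Qed.

(** The upper bound on [/ q k] is [/ p], that is, positivity of the weight at [k]. The previous
    level is assumed for every list and every point of the ball, since each endpoint drops a
    different position. *)
Lemma mixl_le_step s l q x :
  (forall l y, NoDup l -> (forall k, In k l -> (k < m)%nat) -> length l = S s ->
    in_ball K m n y ->
    mixl n (fun _ => 2 * INR (S s) / INR (S (S s))) l (fun y => Cmod (T y)) y <= bh s * N) ->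
  NoDup l -> (forall k, In k l -> (k < m)%nat) -> length l = S (S s) ->
  (forall k, In k l -> 0 < q k /\ / q k < INR (S (S s)) / (2 * INR (S s))) ->
  lsum l (fun k => / q k) = (INR (S (S s)) + 1) / 2 ->
  in_ball K m n x ->
  mixl n q l (fun y => Cmod (T y)) x <= bh (S s) * N.
Proof.
  intros HP Hnd Hlm Hlen Hq Hsum Hx.
  set (p := 2 * INR (S s) / INR (S (S s))) in *.
  pose proof (pos_INR s) as Hs0.
  assert (HS1 : INR (S s) = INR s + 1) by apply S_INR.
  assert (HS2 : INR (S (S s)) = INR s + 2) by (rewrite !S_INR; ring).
  rewrite HS1, HS2 in *.
  assert (Hp : 1 <= p < 2).
  { unfold p; split.
    - apply Rle_div_r; lra.
    - apply Rlt_div_l; lra. }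
  assert (Hip : / p = (INR s + 2) / (2 * (INR s + 1))) by (unfold p; rewrite HS1, HS2; field; lra).
  destruct (A_Khin (S (S s)) ltac:(lia)) as [[HA _] HA0].
  replace ((2 * INR (S (S s)) - 2) / INR (S (S s))) with p in HA
    by (unfold p; rewrite HS1, HS2; field; lra).
  set (W := bh (S s) * N).
  assert (HN : 0 <= N) by (apply (bound_nonneg (K := K) (m := m) (n := n) (T := T)); easy).
  assert (HW : W = / A (S (S s)) * (bh s * N)).
  { unfold W, bh; simpl rprod. replace (s + 2)%nat with (S (S s)) by lia. ring. }
  assert (HbN : 0 <= bh s * N) by (apply Rmult_le_pos; [apply bh_nonneg|easy]).
  assert (HW0 : 0 <= W).
  { rewrite HW; apply Rmult_le_pos; [left; apply Rinv_0_lt_compat|]; easy. }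
  (* interpolation weights: [1/q_k = t_k/2 + (1 - t_k)/p] *)
  set (t := fun k => 2 * (INR s + 1) * (/ p - / q k)).
  assert (Ht : forall i, In i l -> 0 < t i).
  { intros i Hi; apply Rmult_lt_0_compat; [lra|]. rewrite Hip. apply Hq in Hi; lra. }
  (* The factor [2 (s + 1)] in [t] is the inverse of [1/p - 1/2], and also of
     [(s + 2)/p - (s + 3)/2]. *)
  assert (Hts : lsum l t = 1).
  { unfold t. rewrite lsum_scal.
    rewrite (lsum_ext l _ (fun k => / p + (-1) * / q k)) by (intros; ring).
    rewrite lsum_plus, lsum_scal, lsum_const, Hsum, Hlen, Hip, HS2. field; lra. }
  apply Rle_trans with (lprod l (fun i => rpow (mixl n
    (fun k => if Nat.eq_dec k i then 2 else p) l (fun y => Cmod (T y)) x) (t i))).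
  - apply mixl_interpolation; auto.
    + intros; apply Cmod_nonneg.
    + intros k Hk; apply Hq; easy.
    + intros i k _ _; destruct (Nat.eq_dec k i); lra.
    + intros k Hk. rewrite (lsum_remove l k); auto.
      destruct (Nat.eq_dec k k) as [_|]; [|easy].
      rewrite (lsum_ext _ _ (fun i => / p * t i)).
      2: { intros i Hi. destruct (Nat.eq_dec k i) as [->|]; [|ring].
           apply in_remove in Hi; easy. }
      rewrite lsum_scal. rewrite (lsum_remove l k) in Hts by auto.
      replace (lsum _ t) with (1 - t k) by lra.
      unfold t. rewrite Hip. specialize (Hq k Hk). field; lra.
  - apply Rle_trans with (lprod l (fun i => rpow W (t i))).
    + apply lprod_le; intros i Hi. split; [apply rpow_nonneg|].
      apply rpow_le; [left; auto|]. split; [apply mixl_nonneg; intros; apply Cmod_nonneg|].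
      rewrite HW. apply (mixl_endpoint_le (K := K) (m := m) (N := N)); auto; [apply HA0|].
      intros y Hy. apply HP; auto using remove_NoDup.
      * intros k Hk; apply in_remove in Hk; apply Hlm; easy.
      * pose proof (remove_length l i Hnd Hi); lia.
    + rewrite lprod_rpow, Hts, rpow_1; auto; [lra|].
      intros ->; easy.
Qed.

Lemma mixl_diagonal_le s l x :
  NoDup l -> (forall k, In k l -> (k < m)%nat) -> length l = S s -> in_ball K m n x ->
  mixl n (fun _ => 2 * INR (S s) / INR (S (S s))) l (fun y => Cmod (T y)) x <= bh s * N.
Proof.
  revert l x; induction s as [|s IH]; intros l x Hnd Hlm Hlen Hx.
  - destruct l as [|k [|]]; try easy.
    replace (2 * INR 1 / INR 2) with 1 by (simpl; field).
    rewrite mixl_const; [|lra|intros; apply Cmod_nonneg].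
    rewrite Rinv_1, rpow_1 by (apply msum_nonneg; intros; apply rpow_nonneg).
    unfold bh; simpl. rewrite Rmult_1_l.
    rewrite (rsum_ext n _ (fun v => Cmod (T (upd x k (unitv v)))))
      by (intros; apply rpow_1, Cmod_nonneg).
    apply (sum_Cmod_le T_lin T_bound); auto with datatypes.
  - pose proof (pos_INR s) as Hs0.
    assert (HS1 : INR (S s) = INR s + 1) by apply S_INR.
    assert (HS2 : INR (S (S s)) = INR s + 2) by (rewrite !S_INR; ring).
    assert (HS3 : INR (S (S (S s))) = INR s + 3) by (rewrite !S_INR; ring).
    apply (mixl_le_step s l); auto.
    + intros k Hk. rewrite HS1, HS2, HS3. split; [apply Rdiv_lt_0_compat; lra|].
      (* The gap between the reciprocals of [p] and of the diagonal exponent; multiplied by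
         [2 (s + 1)] it gives all weights the value [1/(s + 2)]. *)
      replace ((INR s + 2) / (2 * (INR s + 1))) with
        (/ (2 * (INR s + 2) / (INR s + 3)) + / (2 * (INR s + 1) * (INR s + 2))) by (field; lra).
      assert (0 < / (2 * (INR s + 1) * (INR s + 2))); [|lra].
      apply Rinv_0_lt_compat; nra.
    + rewrite lsum_const, Hlen, HS2, HS3. field; lra.
Qed.

End Induction.

(** * Existence of the optimal constant and conclusion *)

Lemma norm_set_in_ball K m n T r :
  norm_set K m n T r <-> exists x, in_ball K m n x /\ r = Cmod (T x).
Proof.
  split; [intros (x & H1 & H2 & H3)|intros (x & [H1 H2] & H3)]; exists x; repeat split; auto.
Qed.

(** The infimum, obtained as a supremum of negatives, is admissible: divide by [N] when [N > 0].
    When [N = 0] the bound reads the same for every constant, and [c0] supplies it. *)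
Lemma BH_const_exists K m q c0 : BH_admissible K m q c0 ->
  exists B, is_BH_const K m q B /\ B <= c0.
Proof.
  intros Hc0. destruct (completeness (fun c => BH_admissible K m q (- c))) as (b & HU & HL).
  - exists (-1); intros c [Hc _]; lra.
  - exists (- c0); rewrite Ropp_involutive; easy.
  - assert (HUB : forall c, BH_admissible K m q c -> - b <= c).
    { intros c Hc. assert (- c <= b); [|lra]. apply HU; rewrite Ropp_involutive; easy. }
    exists (- b); split; [split; [split|]|]; auto.
    + assert (b <= -1); [|lra]. apply HL; intros c [Hc _]; lra.
    + intros n T N Hn HT HN.
      assert (HN0 : 0 <= N).
      { apply Rle_trans with (Cmod (T (fun _ => unitv O))); [apply Cmod_nonneg|].
        apply HN, norm_set_in_ball; eexists; split; [|easy].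
        apply (in_ball_unitv K m n (fun _ => O)). }
      destruct HN0 as [HN0|HN0].
      * apply Rmult_le_reg_r with (/ N); [apply Rinv_0_lt_compat; easy|].
        rewrite Rmult_assoc, Rinv_r, Rmult_1_r by lra.
        set (c := _ * _). assert (b <= - c); [|lra]. apply HL; intros c' [_ Hc'].
        assert (c <= - c'); [|lra]. unfold c.
        apply Rmult_le_reg_r with N; [easy|].
        rewrite Rmult_assoc, Rinv_l, Rmult_1_r by lra. auto.
      * destruct Hc0 as [_ Hc0]. specialize (Hc0 n T N Hn HT HN).
        rewrite <- HN0, Rmult_0_r in *; easy.
Qed.

Theorem mainTheorem3 (K : field) (m : nat) (q : nat -> R)
  (hm : (2 <= m)%nat)
  (hq : forall k, (k < m)%nat -> 1 <= q k <= 2)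
  (hsum : rsum m (fun k => / q k) = (INR m + 1) / 2)
  (hmax : forall k, (k < m)%nat ->
     q k < (2 * INR m ^ 2 - 4 * INR m + 2) / (INR m ^ 2 - INR m - 1)) :
  exists A : nat -> R,
    (forall j, (2 <= j <= m)%nat -> is_Khin_const K ((2 * INR j - 2) / INR j) (A j)) /\
    exists B : R, is_BH_const K m q B /\
      B <= rprod (m - 1) (fun i => / A (i + 2)%nat).
Proof.
  destruct m as [|[|s]]; [lia|lia|].
  assert (HA : exists A : nat -> R, forall j, (2 <= j)%nat ->
    is_Khin_const K ((2 * INR j - 2) / INR j) (A j) /\ 0 < A j <= 1).
  { exists (fun j => epsilon (inhabits 0)
      (fun c => is_Khin_const K ((2 * INR j - 2) / INR j) c /\ 0 < c <= 1)).
    intros j Hj. apply epsilon_spec, Khin_const_exists.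
    apply le_INR in Hj; simpl in Hj.
    split; [apply Rle_div_r|apply Rle_div_l]; lra. }
  destruct HA as (A & HA). exists A; split; [intros; apply HA; lia|].
  apply BH_const_exists. replace (S (S s) - 1)%nat with (S s) by lia.
  set (l := seq 0 (S (S s))).
  assert (Hnd : NoDup l) by apply seq_NoDup.
  assert (Hlen : length l = S (S s)) by apply length_seq.
  assert (Hl : forall k, In k l <-> (k < S (S s))%nat) by (intros; unfold l; rewrite in_seq; lia).
  rewrite rsum_seq in hsum. fold l in hsum.
  split.
  - clear - HA. generalize (S s); intros r; induction r as [|r IH]; simpl; [lra|].
    rewrite <- (Rmult_1_r 1). apply Rmult_le_compat; try lra.
    destruct (HA (r + 2)%nat ltac:(lia)) as [_ HA1].
    rewrite <- Rinv_1; apply Rinv_le_contravar; lra.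
  - intros n T N _ HT HN. unfold BH_lhs. rewrite mix_mixl. fold l.
    assert (HB : forall x, in_ball K (S (S s)) n x -> Cmod (T x) <= N).
    { intros x Hx; apply HN, norm_set_in_ball; exists x; easy. }
    apply (mixl_le_step HT HB HA); auto using in_ball_unitv.
    + intros; apply (mixl_diagonal_le HT HB HA); auto.
    + intros k Hk; apply Hl; easy.
    + pose proof (pos_INR s) as Hs0.
      assert (HS1 : INR (S s) = INR s + 1) by apply S_INR.
      assert (HS2 : INR (S (S s)) = INR s + 2) by (rewrite !S_INR; ring).
      (* The reciprocal of the bound on [max q_k], with [m = s + 2] and
         [2 m^2 - 4 m + 2 = 2 (m - 1)^2]. *)
      set (c := (INR (S (S s)) ^ 2 - INR (S (S s)) - 1) / (2 * INR (S s) ^ 2)).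
      assert (Hc : forall k, In k l -> 0 < / q k - c).
      { intros k Hk; apply Hl in Hk. specialize (hq k Hk); specialize (hmax k Hk).
        apply Rlt_0_minus. unfold c. rewrite HS1, HS2 in *.
        set (d := 2 * (INR s + 2) ^ 2 - 4 * (INR s + 2) + 2) in *.
        assert (Hd : 2 * (INR s + 1) ^ 2 = d) by (unfold d; ring). rewrite Hd.
        set (e := (INR s + 2) ^ 2 - (INR s + 2) - 1) in *.
        assert (He : 0 < e) by (unfold e; nra).
        assert (Hd0 : 0 < d) by (rewrite <- Hd; nra).
        rewrite <- Rinv_div. apply Rinv_lt_contravar; [|easy].
        apply Rmult_lt_0_compat; [lra|apply Rdiv_lt_0_compat; easy]. }
      intros i Hi. split; [apply Hl in Hi; specialize (hq i Hi); lra|].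
      assert (Hsc : lsum l (fun k => / q k - c) = (INR s + 3) / 2 - (INR s + 2) * c).
      { rewrite (lsum_ext l _ (fun k => / q k + (-1) * c)) by (intros; ring).
        rewrite lsum_plus, lsum_const, hsum, Hlen, HS2. field. }
      rewrite (lsum_remove l i) in Hsc by auto.
      pose proof (remove_length l i Hnd Hi) as Hrl.
      assert (Hpos : 0 < lsum (remove Nat.eq_dec i l) (fun k => / q k - c)).
      { apply lsum_pos.
        - intros E; rewrite E, Hlen in Hrl; easy.
        - intros k Hk; apply in_remove in Hk; apply Hc; easy. }
      (* The other [m - 1] reciprocals each exceed [c], so [/ q i] is below [(m + 1)/2 - (m - 1) c],
         which equals [m/(2 (m - 1))]. *)
      apply Rlt_le_trans with (c + ((INR s + 3) / 2 - (INR s + 2) * c)); [lra|].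
      right. unfold c; rewrite HS1, HS2. field; lra.
Qed.
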